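(* Let $\mathcal{P}=(R,E,S)$ be an $n$-polygraph modulo, and let $\Gamma$ be a square extension of $\mathcal{P}$ such that $\mathcal{P}$ is $\Gamma$-diconvergent. If $\sigma$ and $\rho$ are weakly commuting normalization strategies for $S$ and $E$ respectively, then any square extension $\mathcal{S}(\Gamma)\cup N(\sigma,\rho)$ is coherent, i.e. is acyclic as a square extension of the pair of $(n,n-1)$-categories $(E^\top,S^\top)$.
   Context: **Polygraphs.** $n$-categories are strict and globular; $\star_i$ is composition along $i$-cells; $\partial_-(f),\partial_+(f)$ are the codimension-one source and target of a cell $f$. A cellular extension of a $k$-category $\mathcal{C}$ is a set $X$ with a map from $X$ to the set of $k$-spheres (pairs of parallel $k$-cells) of $\mathcal{C}$; $\mathcal{C}[X]$ is the free $(k+1)$-category obtained by adjoining the elements of $X$ as $(k+1)$-cells. An $n$-polygraph $P=(P_0,\dots,P_n)$ is a set $P_0$ with, for $0\le k<n$, a cellular extension $P_{k+1}$ of $P_k^\ast=P_0[P_1]\cdots[P_k]$; $P^\ast=P_n^\ast$, and $P_{\leq k}=(P_0,\dots,P_k)$. The size of an $n$-cell is the number of generating $n$-cells it contains; $P^{\ast(1)}$ is the set of $n$-cells of size $1$, called rewriting steps. A whisker of $P_{n-1}^\ast$ is a context $C[-]=f_{n-1}\star_{n-2}\cdots\star_1(f_1\star_0 - \star_0 g_1)\star_1\cdots\star_{n-2}g_{n-1}$ with $f_k,g_k$ $k$-cells. $P$ is terminating if there is no infinite sequence of composable rewriting steps, confluent if any two $n$-cells of $P^\ast$ with the same source can be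 completed by $n$-cells of $P^\ast$ to a common target, and convergent if both. **Polygraphs modulo.** An $n$-polygraph modulo $\mathcal{P}=(R,E,S)$ consists of $n$-polygraphs $R$, $E$ with $E_{\leq n-2}=R_{\leq n-2}$, $E_{n-1}\subseteq R_{n-1}$, and a cellular extension $S$ of $R_{n-1}^\ast$ with $R_n\subseteq S\subseteq {}_ER_E$. Here $E^\top$ is the free $(n,n-1)$-category over $R_{n-1}^\ast$ generated by $E_n$ (all $n$-cells invertible; inverse of $e$ written $e^-$), and ${}_ER_E$ is the set of composable triples $(e,f,e')$ with $e,e'$ $n$-cells of $E^\top$, $f\in R_n^{\ast(1)}$, with source $\partial_-(e)$ and target $\partial_+(e')$ (a rule $f$ is identified with $(1,f,1)$, and a whiskered triple $C[(e,f,e')]$ with $(C[e],C[f],C[e'])$). $S^\ast$ (resp. $S^\top$) is the free $n$-category (resp. $(n,n-1)$-category) over $R_{n-1}^\ast$ generated by $S$. $\mathcal{P}$ is terminating if the $n$-polygraph $(R_{\leq n-1},{}_ER_E)$ is terminating. An $(n-1)$-cell of $R_{n-1}^\ast$ is an $S$- (resp. $E$-) normal form if it is the source of no $S$- (resp. $E$-)rewriting step. **Squares.** A square over a pair $(\mathbf V,\mathbf H)$ of $n$-categories with the same underlying $(n-1)$-category is a quadruple with top $f:u\to v$ and bottom $g:u'\to v'$ in $\mathbf H$, left $e:u\to u'$ and right $e':v\to v'$ in $\mathbf V$ ($n$-cells). A square extension of $(\mathbf V,\mathbf H)$ is a set $\Gamma$ with a map to the set of squares (the boundary); its elements are regarded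 as square $(n+1)$-cells. A square extension of $\mathcal{P}$ is a square extension of $(E^\top,S^\ast)$. The Peiffer extension $\mathrm{Peiff}(E^\top,S^\ast)$ has one square cell for each square with top $f\star_i v$, bottom $f\star_i v'$, left $u\star_i e$, right $u'\star_i e$, and each with top $w\star_i f'$, bottom $w'\star_i f'$, left $e'\star_i t$, right $e'\star_i t'$, where $f:u\to u'$, $f':t\to t'$ are in $S^\ast$, $e:v\to v'$, $e':w\to w'$ in $E^\top$, $0\le i\le n-2$. **Biaction.** If $A$ has top $f$, bottom $g$, left $e$, right $e'$, and $e_1,e_2$ are $n$-cells of $E^\top$ with $\partial_+(e_1)=\partial_-(e)$ and $\partial_-(e_2)=\partial_+(e)$ such that $e_1f$ and $e_2^-g$ (obtained by precomposing the first step) are again $n$-cells of $S^\ast$, then ${}^{e_1}_{e_2}A$ is the square cell with top $e_1f$, bottom $e_2^-g$, left $e_1\star_{n-1} e\star_{n-1} e_2$, right $e'$. $E\rtimes\Gamma$ is the set of all defined ${}^{e_1}_{e_2}A$, $A\in\Gamma$. **The structure $\Gamma^{\curlyvee}$.** This is the free $(n-1)$-category enriched in double categories, with invertible vertical cells, generated by $(E,S,E\rtimes\Gamma\cup\mathrm{Peiff}(E^\top,S^\ast))$: its underlying $(n-1)$-category is $R_{n-1}^\ast$, its vertical $n$-cells are those of $E^\top$, its horizontal $n$-cells are those of $S^\ast$, and its square $(n+1)$-cells are all formal pastings, along common vertical edges ($\diamond^v$) and common horizontal edges ($\diamond^h$), of the generating square cells and their images under contexts of $R_{n-1}^\ast$,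 identity squares on horizontal and on vertical cells, and inverses with respect to $\diamond^h$ (the inverse of a square with top $f$, bottom $g$, left $e$, right $e'$ has top $g$, bottom $f$, left $e^-$, right $e'^-$), modulo associativity, unit, inverse and middle-four interchange laws (composites $\star_{n-2}$ of squares are determined by functoriality/exchange relations). **$\Gamma$-diconvergence.** An $S$-branching is a triple $(f,e,g)$ with $f,g$ $n$-cells of $S^\ast$, $f$ nontrivial, $e$ an $n$-cell of $E^\top$, $\partial_-(f)=\partial_-(e)$, $\partial_-(g)=\partial_+(e)$. It is $\Gamma$-confluent if there exist $n$-cells $f',g'$ of $S^\ast$, an $n$-cell $e'$ of $E^\top$, and a square $(n+1)$-cell of $\Gamma^{\curlyvee}$ with top $f\star_{n-1}f'$, bottom $g\star_{n-1}g'$, left $e$, right $e'$. $\mathcal{P}$ is $\Gamma$-diconvergent if it is terminating, every $S$-branching is $\Gamma$-confluent, and the $n$-polygraph $E$ is convergent. **Normalization strategies.** A normalization strategy $\sigma$ for $S$ (resp. $\rho$ for $E$) assigns to each $(n-1)$-cell $u$ of $R_{n-1}^\ast$ an $n$-cell $\sigma_u:u\to\hat u$ of $S^\ast$, with $\hat u$ a chosen $S$-normal form of $u$ (resp. an $n$-cell $\rho_u:u\to\widetilde u$ of $E^\ast$, with $\widetilde u$ the $E$-normal form of $u$). They weakly commute if for every $(n-1)$-cell $u$ of $R_{n-1}^\ast$ there is an $n$-cell $\eta_u:\widetilde u\to\widetilde{\hat u}$ of $S^\ast$. $N(\sigma,\rho)$ denotes the square extension of $\mathcal{P}$ made of the squares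 with top $\sigma_u$, bottom $\eta_u$, left $\rho_u$, right $\rho_{\hat u}$, one for every $(n-1)$-cell $u$ of $R_{n-1}^\ast$. **Squier extensions.** A critical branching of $E$ is a pair $(e,e')$ of $E$-rewriting steps with the same source, not of the form $(e,e)$ nor of the Peiffer form $(e_0\star_i v,u\star_i e_0')$ with $0\le i\le n-2$, and minimal under the action of whiskers. $\mathcal{S}(E)$ denotes a set containing exactly one square cell for each critical branching $(e,e')$ of $E$, with top and bottom identities, left $e\star_{n-1}e_1$ and right $e'\star_{n-1}e_1'$, where $(e_1,e_1')$ is a chosen confluence in $E^\ast$. A Squier extension of $\Gamma$ is $\mathcal{S}(\Gamma)=E\rtimes\Gamma\cup\mathrm{Peiff}(E^\top,S^\ast)\cup\mathcal{S}(E)$. **Coherent (acyclic) extensions.** A square extension $\Lambda$, viewed over $(E^\top,S^\top)$, is acyclic (coherent) if every square over $(E^\top,S^\top)$ is the boundary of a square $(n+1)$-cell of the free $(n-1)$-category enriched in double groupoids generated by $(E,S,\Lambda)$. The latter is constructed like $\Gamma^{\curlyvee}$ but with generating squares $\Lambda$, vertical cells $E^\top$, horizontal cells $S^\top$, and all squares invertible for both $\diamond^v$ and $\diamond^h$. *)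

(* Defs.v *)
From mathcomp Require Import all_boot boolp.

Set Implicit Arguments.
Unset Strict Implicit.
Unset Printing Implicit Defensive.

(* -------------------------------------------------------------------------- *)
(** * Strict globular n-categories *)

(* Single-sorted presentation: [car] is the set of n-cells, and for k < n the
   k-cells are identified with their identities, i.e. with the x such that
   [bd false k x = x].  The sign [false] stands for the source and [true] for
   the target; [bd e i x] is the i-dimensional boundary of x.  [comp i x y]
   is x *_i y in diagrammatic order; it is meaningful only when
   [bd true i x = bd false i y]. *)
Record ncat (n : nat) := NCat {
  car :> Type;
  bd : bool -> nat -> car -> car;
  comp : nat -> car -> car -> car;
  bd_bd : forall d e i j x,
    bd d i (bd e j x) = if i < j then bd d i x else bd e j x;
  bd_dim : forall e i x, n <= i -> bd e i x = x;
  bd_comp : forall e i j x y, bd true i x = bd false i y ->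
    bd e j (comp i x y) =
      if j <= i then bd e j (if e then y else x)
      else comp i (bd e j x) (bd e j y);
  comp_idl : forall i x, comp i (bd false i x) x = x;
  comp_idr : forall i x, comp i x (bd true i x) = x;
  comp_assoc : forall i x y z,
    bd true i x = bd false i y -> bd true i y = bd false i z ->
    comp i (comp i x y) z = comp i x (comp i y z);
  comp_exch : forall i j x y z w, i < j ->
    bd true j x = bd false j y -> bd true j z = bd false j w ->
    bd true i x = bd false i z ->
    comp i (comp j x y) (comp j z w) = comp j (comp i x z) (comp i y w) }.

Arguments bd {n n0} e i x : rename.
Arguments comp {n n0} i x y : rename.

Section Discrete.
Variable X : Type.

Definition discrete : ncat 0.
Proof.
refine (@NCat 0 X (fun _ _ x => x) (fun _ x _ => x) _ _ _ _ _ _ _) => //.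
- by move=> d e i j x; case: ifP.
- by move=> e i j x y /= ->; case: e; case: ifP.
Defined.

End Discrete.

(* A set of generators attached along n-spheres of C; for n = 0 any pair of
   cells is a sphere. *)
Record cellext (n : nat) (C : ncat n) := CellExt {
  gen :> Type;
  gbd : bool -> gen -> C;
  gpar : forall e i x, i < n -> bd e i (gbd false x) = bd e i (gbd true x) }.

Arguments gbd {n C c} e x : rename.

(* -------------------------------------------------------------------------- *)
(** * Free (n+1)-categories over an n-category *)

(* Formal (n+1)-dimensional composites.  [Cel c] is the identity of the cell c
   and [Inv] the formal inverse for *_n, used only for (n+1,n)-categories. *)
Inductive term (n : nat) (C : ncat n) (X : cellext C) : Type :=
| Cel of C
| Gen of X
| Comp of nat & term X & term X
| Inv of term X.

Arguments Cel {n C X} c.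
Arguments Gen {n C X} x.
Arguments Comp {n C X} i a b.
Arguments Inv {n C X} a.

(* i-boundary of a formal composite, meaningful for i <= n. *)
Fixpoint tbd (n : nat) (C : ncat n) (X : cellext C) (e : bool) (i : nat)
    (a : term X) : C :=
  match a with
  | Cel c => bd e i c
  | Gen x => bd e i (gbd e x)
  | Comp j a b =>
      if i <= j then (if e then tbd e i b else tbd e i a)
      else comp j (tbd e i a) (tbd e i b)
  | Inv a => tbd (if i < n then e else ~~ e) i a
  end.

(* The data presenting an (n+1)-category over C: generators, whether the
   (n+1)-cells are to be made invertible, and relations between formal
   composites (none for a free category). *)
Record pres (n : nat) (C : ncat n) := Pres {
  pgen : cellext C;
  pinv : bool;
  prel : term pgen -> term pgen -> Prop }.

Arguments Pres {n C} pgen pinv prel.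

Section Presented.
Variables (n : nat) (C : ncat n) (P : pres C).
Notation T := (term (pgen P)).

Inductive wf : T -> Prop :=
| wf_cel c : wf (Cel c)
| wf_gen x : wf (Gen x)
| wf_comp i a b : wf a -> wf b -> i <= n -> tbd true i a = tbd false i b ->
    wf (Comp i a b)
| wf_inv a : pinv P -> wf a -> wf (Inv a).

Inductive eqv : T -> T -> Prop :=
| eqv_refl a : wf a -> eqv a a
| eqv_sym a b : eqv a b -> eqv b a
| eqv_trans a b c : eqv a b -> eqv b c -> eqv a c
| eqv_comp i a b a' b' : wf (Comp i a b) -> eqv a a' -> eqv b b' ->
    eqv (Comp i a b) (Comp i a' b')
| eqv_inv a b : pinv P -> eqv a b -> eqv (Inv a) (Inv b)
| eqv_cel i c d : i <= n -> bd true i c = bd false i d ->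
    eqv (Comp i (Cel c) (Cel d)) (Cel (comp i c d))
| eqv_idl i a : wf a -> i <= n -> eqv (Comp i (Cel (tbd false i a)) a) a
| eqv_idr i a : wf a -> i <= n -> eqv (Comp i a (Cel (tbd true i a))) a
| eqv_assoc i a b c : wf (Comp i (Comp i a b) c) ->
    eqv (Comp i (Comp i a b) c) (Comp i a (Comp i b c))
| eqv_exch i j a b c d : i < j -> wf (Comp i (Comp j a b) (Comp j c d)) ->
    eqv (Comp i (Comp j a b) (Comp j c d)) (Comp j (Comp i a c) (Comp i b d))
| eqv_invr a : pinv P -> wf a -> eqv (Comp n a (Inv a)) (Cel (tbd false n a))
| eqv_invl a : pinv P -> wf a -> eqv (Comp n (Inv a) a) (Cel (tbd true n a))
| eqv_rel a b : prel a b -> wf a -> wf b ->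
    (forall e i, i <= n -> tbd e i a = tbd e i b) -> eqv a b.

Lemma wf_compE i a b : wf (Comp i a b) ->
  [/\ wf a, wf b, i <= n & tbd true i a = tbd false i b].
Proof.
move E: (Comp i a b) => t h; case: h E => // i0 a0 b0 ha hb hi hc.
by case=> -> -> ->.
Qed.

Lemma wf_invE a : wf (Inv a) -> pinv P /\ wf a.
Proof. by move E: (Inv a) => t h; case: h E => // a0 hi ha [->]. Qed.

Lemma bd_tbd d e i j a : wf a -> j <= n ->
  bd d i (tbd e j a) = if i < j then tbd d i a else tbd e j a.
Proof.
move=> h; elim: h d e i j => {a}
  [c|x|k a b ha IHa hb IHb hk hc|a hinv ha IHa] d e i j hj /=.
- exact: bd_bd.
- rewrite bd_bd; case: ifP => // lij.
  have lin : i < n by apply: leq_trans hj.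
  by case: e; case: d => //; rewrite gpar.
- have par d' i' : i' < k -> tbd d' i' a = tbd d' i' b.
    move=> li; have := congr1 (bd d' i') hc.
    by rewrite IHa // IHb // li.
  have [ljk|lkj] := leqP j k.
  + have -> : bd d i (if e then tbd e j b else tbd e j a) =
        if i < j then tbd d i (if e then b else a)
        else tbd e j (if e then b else a) by case: (e); [exact: IHb|exact: IHa].
    case: (boolP (i < j)) => lij; last by case: (e).
    have lik : i < k by apply: leq_trans ljk.
    by rewrite (ltnW lik); case: (e); case: (d); rewrite ?par.
  + have cc : bd true k (tbd e j a) = bd false k (tbd e j b).
      by rewrite IHa // IHb // lkj.
    rewrite bd_comp //; have [lik|lki] := leqP i k.
    * rewrite (leq_ltn_trans lik lkj).
      by case: d; rewrite ?IHa ?IHb // (leq_ltn_trans lik lkj).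
    * by rewrite IHa // IHb //; case: ifP.
- case: (boolP (i < j)) => lij.
  + by rewrite IHa // lij (leq_trans lij hj).
  + by rewrite IHa // (negbTE lij).
Qed.

Lemma eqv_props a b : eqv a b ->
  [/\ wf a, wf b & forall e i, i <= n -> tbd e i a = tbd e i b].
Proof.
elim=> {a b}.
- by [].
- by move=> a b _ [ha hb h]; split=> // e i hi; rewrite h.
- by move=> a b c _ [ha hb h] _ [_ hc h']; split=> // e i hi; rewrite h ?h'.
- move=> i a b a' b' /wf_compE[ha hb hi hc] _ [_ ha' h] _ [_ hb' h'].
  split; [exact: wf_comp|by apply: wf_comp; rewrite -?h -?h'|].
  by move=> e j hj /=; rewrite !h // !h'.
- move=> a b hi _ [ha hb h]; split; [exact: wf_inv|exact: wf_inv|].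
  by move=> e j hj /=; rewrite h.
- move=> i c d hi hc; split; [by apply: wf_comp => //; apply: wf_cel|exact: wf_cel|].
  by move=> e j hj /=; rewrite bd_comp //; case: e.
- move=> i a ha hi; have w : wf (Comp i (Cel (tbd false i a)) a).
    by apply: wf_comp => //; [apply: wf_cel|rewrite /= bd_tbd // ltnn].
  split=> // e j hj /=; case: (leqP j i) => [lji|lij].
    case: e => //; rewrite bd_tbd //; case: ltnP => // lij.
    by have -> : j = i by apply/eqP; rewrite eqn_leq lji lij.
  rewrite bd_tbd // ltnNge (ltnW lij) /=.
  by have := comp_idl i (tbd e j a); rewrite bd_tbd // lij.
- move=> i a ha hi; have w : wf (Comp i a (Cel (tbd true i a))).
    by apply: wf_comp => //; [apply: wf_cel|rewrite /= bd_tbd // ltnn].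
  split=> // e j hj /=; case: (leqP j i) => [lji|lij].
    case: e => //; rewrite bd_tbd //; case: ltnP => // lij.
    by have -> : j = i by apply/eqP; rewrite eqn_leq lji lij.
  rewrite bd_tbd // ltnNge (ltnW lij) /=.
  by have := comp_idr i (tbd e j a); rewrite bd_tbd // lij.
- move=> i a b c w; have [/wf_compE[ha hb hi hab] hc _ hbc] := wf_compE w.
  move: hbc => /=; rewrite leqnn => hbc.
  split=> //.
    by apply: wf_comp => //; [exact: wf_comp|rewrite /= leqnn].
  move=> e j hj /=; case: (leqP j i) => [lji|lij].
    by case: e; rewrite // ?lji.
  by rewrite comp_assoc // !bd_tbd // lij.
- move=> i j a b c d lij w.
  have [/wf_compE[ha hb hj hab] /wf_compE[hc hd _ hcd] hi] := wf_compE w.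
  rewrite /= (ltnW lij) => hbc.
  have par x y : wf x -> wf y -> tbd true j x = tbd false j y ->
      forall e, tbd e i x = tbd e i y.
    by move=> hx hy hxy e; have := congr1 (bd e i) hxy; rewrite !bd_tbd // lij.
  have hac : tbd true i a = tbd false i c by rewrite (par a b).
  have hbd : tbd true i b = tbd false i d by rewrite hbc (par c d).
  split=> //.
    apply: wf_comp => //; [exact: wf_comp|exact: wf_comp|].
    by rewrite /= leqNgt lij /= hab hcd.
  move=> e m hm /=; case: (leqP m i) => [lmi|lim].
    by rewrite (leq_trans lmi (ltnW lij)); case: e.
  case: (leqP m j) => [lmj|ljm]; first by case: e.
  by rewrite comp_exch // !bd_tbd // ?ljm ?lim.
- move=> a hi ha; split.
  + apply: wf_comp => //; [exact: wf_inv|by rewrite /= ltnn].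
  + exact: wf_cel.
  + move=> e i hin /=; rewrite hin bd_tbd //.
    case: ltnP => [lin|lni]; first by case: e.
    have -> : i = n by apply/eqP; rewrite eqn_leq hin lni.
    by case: e.
- move=> a hi ha; split.
  + apply: wf_comp => //; [exact: wf_inv|by rewrite /= ltnn].
  + exact: wf_cel.
  + move=> e i hin /=; rewrite hin bd_tbd //.
    case: ltnP => [lin|lni]; first by case: e.
    have -> : i = n by apply/eqP; rewrite eqn_leq hin lni.
    by case: e.
- by [].
Qed.

(* Cells are classes of well-formed formal composites. *)
Record cell := Cell { cls : T -> Prop; clsP : exists2 a, wf a & cls = eqv a }.

Definition repr (q : cell) : T := s2val (cid2 (clsP q)).

Lemma repr_wf q : wf (repr q).
Proof. by rewrite /repr; case: cid2. Qed.

Lemma cls_repr q : cls q = eqv (repr q).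
Proof. by rewrite /repr; case: cid2. Qed.

(* The class of a; [d] is the junk value used when a is ill-formed. *)
Definition mk (d : cell) (a : T) : cell :=
  match pselect (wf a) with
  | left h => Cell (ex_intro2 _ _ a h erefl)
  | right _ => d
  end.

Lemma cls_inj p q : cls p = cls q -> p = q.
Proof.
case: p => [f pf]; case: q => [g pg] /= e; move: pg; rewrite -e => pg.
by congr Cell; exact: Prop_irrelevance.
Qed.

Lemma cell_eq p q : eqv (repr p) (repr q) -> p = q.
Proof.
move=> h; apply: cls_inj; rewrite !cls_repr; apply/funext => x.
apply/propext; split=> k; first exact: eqv_trans (eqv_sym h) k.
exact: eqv_trans h k.
Qed.

Lemma repr_mk d a : wf a -> eqv (repr (mk d a)) a.
Proof.
move=> h; rewrite /mk; case: pselect => // h'.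
rewrite -cls_repr /=; exact: eqv_refl.
Qed.

Lemma mk_eq d d' a b : eqv a b -> mk d a = mk d' b.
Proof.
move=> h; have [ha hb _] := eqv_props h; apply: cell_eq.
apply: eqv_trans (repr_mk _ ha) _; apply: eqv_trans h _.
exact/eqv_sym/repr_mk.
Qed.

Lemma mk_repr d q : mk d (repr q) = q.
Proof. by apply: cell_eq; apply: repr_mk; exact: repr_wf. Qed.

Definition idc (c : C) : cell :=
  Cell (ex_intro2 _ _ (Cel c) (wf_cel c) erefl).

Definition genc (x : pgen P) : cell :=
  Cell (ex_intro2 _ _ (Gen x) (wf_gen x) erefl).

(* Boundary of an (n+1)-cell as a cell of C; [cbd false n q] and
   [cbd true n q] are its codimension-one source and target. *)
Definition cbd (e : bool) (i : nat) (q : cell) : C := tbd e i (repr q).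

Definition src (q : cell) : C := cbd false n q.
Definition tgt (q : cell) : C := cbd true n q.

Definition pbd (e : bool) (i : nat) (q : cell) : cell :=
  if i <= n then idc (cbd e i q) else q.

Definition pcomp (i : nat) (p q : cell) : cell := mk p (Comp i (repr p) (repr q)).

Definition invc (q : cell) : cell := mk q (Inv (repr q)).

Lemma mk_idc d c : mk d (Cel c) = idc c.
Proof.
rewrite /mk; case: pselect => [h|[]]; last exact: wf_cel.
exact: cls_inj.
Qed.

Lemma cbd_mk d e i a : wf a -> i <= n -> cbd e i (mk d a) = tbd e i a.
Proof. by move=> h hi; rewrite /cbd; have [_ _ ->] := eqv_props (repr_mk d h). Qed.

Lemma cbd_idc e i c : i <= n -> cbd e i (idc c) = bd e i c.
Proof. by move=> hi; rewrite -(mk_idc (idc c)) cbd_mk //; exact: wf_cel. Qed.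

Lemma src_idc c : src (idc c) = c.
Proof. by rewrite /src cbd_idc // bd_dim. Qed.

Lemma tgt_idc c : tgt (idc c) = c.
Proof. by rewrite /tgt cbd_idc // bd_dim. Qed.

Lemma bd_cbd d e i j q : j <= n ->
  bd d i (cbd e j q) = if i < j then cbd d i q else cbd e j q.
Proof. by move=> hj; rewrite bd_tbd //; exact: repr_wf. Qed.

Lemma idc_inj c d : idc c = idc d -> c = d.
Proof.
by move=> /(congr1 (cbd false n)); rewrite !cbd_idc // !bd_dim.
Qed.

Lemma pbd_compat i p q : i <= n ->
  pbd true i p = pbd false i q <-> cbd true i p = cbd false i q.
Proof.
move=> hi; rewrite /pbd hi; split=> [|->] //; exact: idc_inj.
Qed.

Lemma wf_pcomp i p q : i <= n -> pbd true i p = pbd false i q ->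
  wf (Comp i (repr p) (repr q)).
Proof.
move=> hi /(pbd_compat _ _ hi) h.
by apply: wf_comp => //; exact: repr_wf.
Qed.

Lemma pcomp_hi i p q : n < i -> pcomp i p q = p.
Proof.
move=> hi; rewrite /pcomp /mk; case: pselect => // w.
by have [_ _] := wf_compE w; rewrite leqNgt hi.
Qed.

Lemma pcomp_mk i d p q a b : eqv (repr p) a -> eqv (repr q) b ->
  wf (Comp i (repr p) (repr q)) -> pcomp i p q = mk d (Comp i a b).
Proof. by move=> ha hb w; apply: mk_eq; apply: eqv_comp. Qed.

Lemma repr_pcomp i p q : wf (Comp i (repr p) (repr q)) ->
  eqv (repr (pcomp i p q)) (Comp i (repr p) (repr q)).
Proof. exact: repr_mk. Qed.

Lemma repr_idc c : eqv (repr (idc c)) (Cel c).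
Proof. by rewrite -(mk_idc (idc c)); apply: repr_mk; exact: wf_cel. Qed.

Lemma repr_genc x : eqv (repr (genc x)) (Gen x).
Proof.
have -> : genc x = mk (genc x) (Gen x); last exact: repr_mk (wf_gen x).
rewrite /mk; case: pselect => [h|[]]; last exact: wf_gen.
exact: cls_inj.
Qed.

Lemma cbd_genc e x : cbd e n (genc x) = gbd e x.
Proof.
by rewrite /cbd; have [_ _ ->] := eqv_props (repr_genc x); rewrite //= bd_dim.
Qed.

Lemma wf_eqv_comp i a b a' b' : wf (Comp i a b) -> eqv a a' -> eqv b b' ->
  wf (Comp i a' b').
Proof. by move=> w ha hb; have [] := eqv_props (eqv_comp w ha hb). Qed.

Definition pres_cat : ncat n.+1.
Proof.
refine (@NCat n.+1 cell pbd pcomp _ _ _ _ _ _ _).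
- move=> d e i j q; rewrite /pbd.
  case: (leqP j n) => [hj|hj]; last first.
    case: (leqP i n) => hi; last by rewrite !if_same.
    by rewrite (leq_ltn_trans hi hj).
  case: (leqP i n) => hi.
    by rewrite cbd_idc // bd_cbd //; case: ifP.
  by rewrite ltnNge (leq_trans hj (ltnW hi)).
- by move=> e i q hi; rewrite /pbd leqNgt hi.
- move=> e i j p q; case: (leqP i n) => [hi|hi]; last first.
    rewrite /pbd leqNgt hi /= => epq; subst q; rewrite !pcomp_hi // !if_same.
    by case: ifP => // _; case: ifP.
  move=> hc; have w := wf_pcomp hi hc.
  rewrite {1}/pbd; case: (leqP j n) => hj; last first.
    by rewrite /pbd (leqNgt j i) (leq_ltn_trans hi hj) /= leqNgt hj.
  rewrite /pcomp cbd_mk //=; case: (leqP j i) => [lji|lij].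
    by rewrite /pbd hj; case: e.
  rewrite /pbd hj; move/(pbd_compat _ _ hi): hc => hc.
  rewrite -(mk_idc p); apply: mk_eq; apply: eqv_sym.
  have hc' : bd true i (cbd e j p) = bd false i (cbd e j q).
    by rewrite !bd_cbd // lij.
  have h := eqv_cel hi hc'.
  apply: eqv_trans h; apply: eqv_comp; try exact: repr_idc.
  by apply: wf_pcomp => //; apply/pbd_compat => //; rewrite !cbd_idc.
- move=> i q; case: (leqP i n) => [hi|hi]; last by rewrite pcomp_hi // /pbd leqNgt hi.
  have w : wf (Comp i (repr (pbd false i q)) (repr q)).
    apply: wf_pcomp => //; apply/pbd_compat => //.
    by rewrite /pbd hi cbd_idc // bd_cbd // ltnn.
  rewrite -[RHS](mk_repr q); apply: mk_eq.
  apply: eqv_trans (eqv_idl (repr_wf q) hi); apply: eqv_comp => //.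
    by rewrite /pbd hi; exact: repr_idc.
  exact/eqv_refl/repr_wf.
- move=> i q; case: (leqP i n) => [hi|hi]; last by rewrite pcomp_hi.
  have w : wf (Comp i (repr q) (repr (pbd true i q))).
    apply: wf_pcomp => //; apply/pbd_compat => //.
    by rewrite /pbd hi cbd_idc // bd_cbd // ltnn.
  rewrite -[RHS](mk_repr q); apply: mk_eq.
  apply: eqv_trans (eqv_idr (repr_wf q) hi); apply: eqv_comp => //.
    exact/eqv_refl/repr_wf.
  by rewrite /pbd hi; exact: repr_idc.
- move=> i p q r; case: (leqP i n) => [hi|hi]; last by rewrite !pcomp_hi.
  move=> h1 h2; have w1 := wf_pcomp hi h1; have w2 := wf_pcomp hi h2.
  have rf x : eqv (repr x) (repr x) by apply/eqv_refl/repr_wf.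
  have w3 : wf (Comp i (Comp i (repr p) (repr q)) (repr r)).
    apply: wf_comp => //; first exact: repr_wf.
    by rewrite /= leqnn; move/(pbd_compat _ _ hi): h2.
  have [_ w4 _] := eqv_props (eqv_assoc w3).
  have e1 := eqv_sym (repr_pcomp w1); have e2 := eqv_sym (repr_pcomp w2).
  rewrite (@pcomp_mk i p (pcomp i p q) r _ _ (eqv_sym e1) (rf r));
    last exact: wf_eqv_comp w3 e1 (rf r).
  rewrite (@pcomp_mk i p p (pcomp i q r) _ _ (rf p) (eqv_sym e2));
    last exact: wf_eqv_comp w4 (rf p) e2.
  exact/mk_eq/eqv_assoc.
- move=> i j p q r t lij; case: (leqP j n) => [hj|hj]; last first.
    by move=> _ _ _; rewrite !(pcomp_hi _ _ hj).
  have hi : i <= n by apply: leq_trans (ltnW lij) hj.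
  move=> h1 h2 h3; have w1 := wf_pcomp hj h1; have w2 := wf_pcomp hj h2.
  have w3 := wf_pcomp hi h3.
  have par x y : pbd true j x = pbd false j y ->
      forall e, cbd e i x = cbd e i y.
    move=> /(pbd_compat _ _ hj) hxy e.
    by have := congr1 (bd e i) hxy; rewrite !bd_cbd // lij.
  have w4 : wf (Comp i (repr q) (repr t)).
    apply: wf_pcomp => //; apply/pbd_compat => //.
    by rewrite -(par p q) // -(par r t) //; apply/pbd_compat.
  have W : wf (Comp i (Comp j (repr p) (repr q)) (Comp j (repr r) (repr t))).
    apply: wf_comp => //=; rewrite (ltnW lij) -/(cbd true i q) -(par p q) //.
    by move/(pbd_compat _ _ hi): h3.
  have [_ W' _] := eqv_props (eqv_exch lij W).
  have e1 := repr_pcomp w1; have e2 := repr_pcomp w2.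
  have e3 := repr_pcomp w3; have e4 := repr_pcomp w4.
  rewrite (@pcomp_mk i p _ _ _ _ e1 e2); last exact: wf_eqv_comp W (eqv_sym e1) (eqv_sym e2).
  rewrite (@pcomp_mk j p _ _ _ _ e3 e4); last exact: wf_eqv_comp W' (eqv_sym e3) (eqv_sym e4).
  exact/mk_eq/eqv_exch.
Defined.

End Presented.

Arguments idc {n C P} c.
Arguments genc {n C P} x.

(* Composition of (n+1)-cells along their codimension-one boundary. *)
Definition vcomp (n : nat) (C : ncat n) (P : pres C) (p q : cell P) : cell P :=
  pcomp n p q.

Notation "p ** q" := (vcomp p q) (at level 45, left associativity).

Definition free_pres (n : nat) (C : ncat n) (X : cellext C) : pres C :=
  Pres X false (fun _ _ => False).

(* The free (n+1,n)-category over C generated by X. *)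
Definition free_inv_pres (n : nat) (C : ncat n) (X : cellext C) : pres C :=
  Pres X true (fun _ _ => False).

(* -------------------------------------------------------------------------- *)
(** * Functors *)

Record functor (n m : nat) (C : ncat n) (D : ncat m) := Functor {
  fmap :> C -> D;
  fmap_bd : forall e i x, fmap (bd e i x) = bd e i (fmap x);
  fmap_comp : forall i x y, bd true i x = bd false i y ->
    fmap (comp i x y) = comp i (fmap x) (fmap y) }.

Fixpoint tmap (n : nat) (C : ncat n) (X Y : cellext C) (phi : X -> Y)
    (a : term X) : term Y :=
  match a with
  | Cel c => Cel c
  | Gen x => Gen (phi x)
  | Comp i a b => Comp i (tmap phi a) (tmap phi b)
  | Inv a => Inv (tmap phi a)
  end.

Lemma tmap_id (n : nat) (C : ncat n) (X : cellext C) (a : term X) :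
  tmap id a = a.
Proof. by elim: a => //= [i a -> b ->|a ->]. Qed.

(* The functor, identical on C, induced by a map of generators. *)
Definition pmap (n : nat) (C : ncat n) (P Q : pres C) (phi : pgen P -> pgen Q)
    (q : cell P) : cell Q :=
  mk (idc (src q)) (tmap phi (repr q)).

Section PresMap.
Variables (n : nat) (C : ncat n) (P Q : pres C) (phi : pgen P -> pgen Q).
Hypothesis phi_bd : forall e x, gbd e (phi x) = gbd e x.
Hypothesis phi_inv : pinv P -> pinv Q.
Hypothesis phi_rel : forall a b, prel a b -> prel (tmap phi a) (tmap phi b).

Lemma tbd_tmap e i a : tbd e i (tmap phi a) = tbd e i a.
Proof.
elim: a e => //= [x|j a IHa b IHb] e; first by rewrite phi_bd.
by rewrite !IHa !IHb.
Qed.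

Lemma wf_tmap a : wf a -> wf (tmap phi a).
Proof.
elim=> {a} [c|x|i a b _ ha _ hb hi hc|a hi _ ha] /=.
- exact: wf_cel.
- exact: wf_gen.
- by apply: wf_comp => //; rewrite !tbd_tmap.
- by apply: wf_inv => //; exact: phi_inv.
Qed.

Lemma eqv_tmap a b : eqv a b -> eqv (tmap phi a) (tmap phi b).
Proof.
elim=> {a b} /=.
- by move=> a /wf_tmap; exact: eqv_refl.
- by move=> a b _; exact: eqv_sym.
- by move=> a b c _ h _; exact: eqv_trans h.
- by move=> i a b a' b' /wf_tmap w _ ha _ hb; exact: eqv_comp.
- by move=> a b /phi_inv hi _; exact: eqv_inv.
- by move=> i c d hi hc; exact: eqv_cel.
- by move=> i a /wf_tmap w hi; rewrite -tbd_tmap; exact: eqv_idl.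
- by move=> i a /wf_tmap w hi; rewrite -tbd_tmap; exact: eqv_idr.
- by move=> i a b c /wf_tmap w; exact: eqv_assoc.
- by move=> i j a b c d lij /wf_tmap w; exact: eqv_exch.
- by move=> a /phi_inv hi /wf_tmap w; rewrite -tbd_tmap; exact: eqv_invr.
- by move=> a /phi_inv hi /wf_tmap w; rewrite -tbd_tmap; exact: eqv_invl.
- move=> a b /phi_rel r /wf_tmap wa /wf_tmap wb h; apply: eqv_rel => // e i hi.
  by rewrite !tbd_tmap h.
Qed.

Lemma repr_pmap q : eqv (repr (pmap phi q)) (tmap phi (repr q)).
Proof. by apply: repr_mk; apply: wf_tmap; exact: repr_wf. Qed.

Lemma cbd_pmap e i q : i <= n -> cbd e i (pmap phi q) = cbd e i q.
Proof.
move=> hi; rewrite /cbd; have [_ _ ->] := eqv_props (repr_pmap q) => //.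
exact: tbd_tmap.
Qed.

Lemma pmap_idc c : pmap phi (idc c) = idc c.
Proof.
rewrite -[RHS](mk_idc (idc c)); apply: mk_eq.
exact: (eqv_tmap (repr_idc P c)).
Qed.

Definition pres_functor : functor (pres_cat P) (pres_cat Q).
Proof.
refine (@Functor n.+1 n.+1 (pres_cat P) (pres_cat Q) (pmap phi) _ _).
- move=> e i q /=; rewrite /pbd; case: (leqP i n) => // hi.
  by rewrite pmap_idc cbd_pmap.
- move=> i p q; case: (leqP i n) => [hi|hi]; last by rewrite /= !pcomp_hi.
  move=> hc; have w := wf_pcomp hi hc.
  have ep := repr_pmap p; have eq := repr_pmap q.
  have w' := wf_tmap w; have e := eqv_tmap (repr_pcomp w).
  rewrite /= [RHS](pcomp_mk (idc (src (pcomp i p q))) ep eq).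
    exact: mk_eq.
  exact: wf_eqv_comp w' (eqv_sym ep) (eqv_sym eq).
Defined.

End PresMap.

Definition subext (n : nat) (C : ncat n) (X : cellext C) (D : X -> Prop) :
    cellext C :=
  @CellExt n C {x | D x} (fun e x => gbd e (sval x))
    (fun e i x hi => gpar e (sval x) hi).

Definition push (n : nat) (C D : ncat n) (F : functor C D) (X : cellext C) :
    cellext D.
Proof.
refine (@CellExt n D X (fun e x => F (gbd e x)) _).
by move=> e i x hi; rewrite -!fmap_bd gpar.
Defined.

(* -------------------------------------------------------------------------- *)
(** * Polygraphs *)

(* The type of n-polygraphs, together with the map P |-> P^*. *)
Fixpoint polycat (n : nat) : {T : Type & T -> ncat n} :=
  match n with
  | 0 => existT (fun T => T -> ncat 0) Type discrete
  | m.+1 =>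
      existT (fun T => T -> ncat m.+1)
        {P : projT1 (polycat m) & cellext (projT2 (polycat m) P)}
        (fun P => pres_cat (free_pres (projT2 P)))
  end.

Definition polygraph (n : nat) : Type := projT1 (polycat n).
Definition fcat (n : nat) (P : polygraph n) : ncat n := projT2 (polycat n) P.

Definition trunc (n : nat) (P : polygraph n.+1) : polygraph n := projT1 P.
Definition rules (n : nat) (P : polygraph n.+1) : cellext (fcat (trunc P)) :=
  projT2 P.
Definition extend (n : nat) (P : polygraph n) (X : cellext (fcat P)) :
    polygraph n.+1 := existT _ P X.

Definition topgen (n : nat) : polygraph n -> Type :=
  match n with
  | 0 => fun P => P
  | m.+1 => fun P => gen (rules P)
  end.

(* The polygraph with the same generators as P in dimensions < n, and with the
   n-dimensional generators satisfying D. *)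
Definition restrict (n : nat) :
    forall P : polygraph n, (topgen P -> Prop) -> polygraph n :=
  match n with
  | 0 => fun P D => {x : P | D x}
  | m.+1 => fun P D => @extend m (trunc P) (subext D)
  end.

Definition restrict_incl (n : nat) :
  forall (P : polygraph n) (D : topgen P -> Prop),
    functor (fcat (restrict D)) (fcat P).
Proof.
case: n => [|m] P D.
- by refine (@Functor 0 0 (discrete _) (discrete _) sval _ _).
- refine (@pres_functor m (fcat (trunc P)) (free_pres (subext D))
    (free_pres (rules P)) sval _ _ _) => //.
Defined.

(* -------------------------------------------------------------------------- *)
(** * Whiskers, size, rewriting *)

Section Whiskers.
Variables (n : nat) (C : ncat n).

(* The context f_n *_{n-1} ... (f_1 *_0 - *_0 g_1) ... *_{n-1} g_n, stored as
   c j = (f_{j+1}, g_{j+1}); only the entries j < n are used. *)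
Definition ctx := nat -> C * C.

Definition is_ctx (c : ctx) : Prop := forall j, j < n ->
  bd false j.+1 (c j).1 = (c j).1 /\ bd false j.+1 (c j).2 = (c j).2.

Fixpoint twhisk (X : cellext C) (c : ctx) (j : nat) (a : term X) : term X :=
  match j with
  | 0 => a
  | i.+1 => Comp i (Comp i (Cel (c i).1) (twhisk c i a)) (Cel (c i).2)
  end.

Variable P : pres C.

(* c[q] is defined *)
Definition whiskable (c : ctx) (q : cell P) : Prop :=
  is_ctx c /\ @wf n C P (twhisk c n (repr q)).

Definition whisk (c : ctx) (q : cell P) : cell P :=
  mk q (twhisk c n (repr q)).

Fixpoint tsize (X : cellext C) (a : term X) : nat :=
  match a with
  | Cel _ => 0
  | Gen _ => 1
  | Comp _ a b => tsize a + tsize b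
  | Inv a => tsize a
  end.

(* Number of generating (n+1)-cells; meaningful when [pinv P = false] and the
   relations of P preserve [tsize]. *)
Definition csize (q : cell P) : nat := tsize (repr q).

Lemma eqv_size a b : pinv P = false ->
  (forall a b, prel a b -> @tsize (pgen P) a = tsize b) ->
  @eqv n C P a b -> tsize a = tsize b.
Proof.
move=> hinv hrel; elim=> {a b} //=.
- by move=> a b c _ -> _ ->.
- by move=> i a b a' b' _ _ -> _ ->.
- by move=> i a _ _; rewrite addn0.
- by move=> *; rewrite addnA.
- by move=> i j a b c d _ _; rewrite addnACA.
- by move=> a; rewrite hinv.
- by move=> a; rewrite hinv.
- by move=> a b /hrel.
Qed.

Definition rewriting_step (q : cell P) : Prop := csize q = 1.

Definition normal_form (u : C) : Prop :=
  forall q : cell P, rewriting_step q -> src q <> u.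

End Whiskers.

Lemma size_genc (n : nat) (C : ncat n) (X : cellext C) (x : X) :
  rewriting_step (genc (P := free_pres X) x).
Proof. by rewrite /rewriting_step /csize (eqv_size _ _ (repr_genc _)). Qed.

Definition terminating (n : nat) (P : polygraph n.+1) : Prop :=
  ~ exists u : nat -> cell (free_pres (rules P)),
      forall i, rewriting_step (u i) /\ tgt (u i) = src (u i.+1).

Definition confluent (n : nat) (P : polygraph n.+1) : Prop :=
  forall f g : cell (free_pres (rules P)), src f = src g ->
  exists f' g' : cell (free_pres (rules P)),
    [/\ src f' = tgt f, src g' = tgt g & tgt f' = tgt g'].

Definition convergent (n : nat) (P : polygraph n.+1) : Prop :=
  terminating P /\ confluent P.

(* -------------------------------------------------------------------------- *)
(** * Polygraphs modulo *)

Section Triples.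
Variables (n : nat) (C : ncat n) (E R : cellext C).

Record triple := Triple {
  t_pre : cell (free_inv_pres E);
  t_mid : cell (free_pres R);
  t_post : cell (free_inv_pres E);
  t_step : rewriting_step t_mid;
  t_src : tgt t_pre = src t_mid;
  t_tgt : tgt t_mid = src t_post }.

Definition ere : cellext C.
Proof.
refine (@CellExt n C triple
  (fun e t => if e then tgt (t_post t) else src (t_pre t)) _).
move=> e i [a f b /= _ h1 h2] hi.
rewrite /src /tgt !bd_cbd // hi.
have /(congr1 (bd e i)) := h1; have /(congr1 (bd e i)) := h2.
by rewrite /src /tgt !bd_cbd // hi => <- <-.
Defined.

(* (1, r, 1) *)
Definition rule_triple (r : R) : ere.
Proof.
refine (@Triple (idc (gbd false r)) (genc (P := free_pres R) r)
  (idc (gbd true r)) _ _ _).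
- exact: size_genc.
- by rewrite /tgt /src cbd_idc // bd_dim // cbd_genc.
- by rewrite /tgt /src cbd_idc // bd_dim // cbd_genc.
Defined.

Variable S : ere -> Prop.

(* Whiskered triples c[x] and d[y] are identified when they are equal
   componentwise. *)
Definition triple_rel (a b : term (subext S)) : Prop :=
  exists (x y : subext S) (c d : ctx C),
    [/\ is_ctx c, is_ctx d, a = twhisk c n (Gen x) & b = twhisk d n (Gen y)] /\
    [/\ whisk c (t_pre (sval x)) = whisk d (t_pre (sval y)),
        whisk c (t_mid (sval x)) = whisk d (t_mid (sval y)) &
        whisk c (t_post (sval x)) = whisk d (t_post (sval y))].

End Triples.

(* An (n+1)-polygraph modulo (R, E, S): [E_sub] selects the n-generators of E
   among those of R, and [E_rules] is the set of (n+1)-generators of E. *)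
Record polygraph_modulo (n : nat) := PolygraphModulo {
  pm_R : polygraph n.+1;
  E_sub : topgen (trunc pm_R) -> Prop;
  E_rules : cellext (fcat (restrict E_sub));
  pm_S : ere (push (restrict_incl E_sub) E_rules) (rules pm_R) -> Prop;
  R_sub_S : forall r : rules pm_R, pm_S (rule_triple _ r) }.

(* -------------------------------------------------------------------------- *)
(** * Squares and free enriched double categories *)

Section Squares.
Variables (n : nat) (C : ncat n) (V H : pres C).

Record square := Square {
  sq_top : cell H;
  sq_bot : cell H;
  sq_left : cell V;
  sq_right : cell V;
  sq_tl : src sq_top = src sq_left;
  sq_tr : tgt sq_top = src sq_right;
  sq_bl : src sq_bot = tgt sq_left;
  sq_br : tgt sq_bot = tgt sq_right }.

Record sqext := SqExt {
  sqcell :> Type;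
  sqbd : sqcell -> square }.

Definition squnion (A B : sqext) : sqext :=
  @SqExt (A + B)%type
    (fun x => match x with inl a => sqbd a | inr b => sqbd b end).

(* Formal pastings of the cells of L, indexed by their top, bottom, left and
   right boundary.  The square cells of the free structure are the classes of
   these pastings modulo laws that preserve the boundary, so a boundary is
   filled in the free structure if and only if this type is inhabited.  For
   V with invertible cells, [dinv_h] gives the inverses for horizontal pasting;
   [dinv_v] only exists when the cells of H are invertible as well.  The four
   edges of a square have the same boundary in dimensions < n, so a context
   applies to all of them or to none. *)
Inductive dcell (L : sqext) : cell H -> cell H -> cell V -> cell V -> Type :=
| dgen (c : ctx C) (A : L) : whiskable c (sq_top (sqbd A)) ->
    dcell L (whisk c (sq_top (sqbd A))) (whisk c (sq_bot (sqbd A)))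
            (whisk c (sq_left (sqbd A))) (whisk c (sq_right (sqbd A)))
| did_h f : dcell L f f (idc (src f)) (idc (tgt f))
| did_v e : dcell L (idc (src e)) (idc (tgt e)) e e
| dpaste_v f g f' g' e e' e'' : dcell L f g e e' -> dcell L f' g' e' e'' ->
    dcell L (f ** f') (g ** g') e e''
| dpaste_h f g h e e' d d' : dcell L f g e e' -> dcell L g h d d' ->
    dcell L f h (e ** d) (e' ** d')
| dinv_h f g e e' : pinv V -> dcell L f g e e' ->
    dcell L g f (invc e) (invc e')
| dinv_v f g e e' : pinv H -> dcell L f g e e' ->
    dcell L (invc f) (invc g) e' e.

Definition filled (L : sqext) f g e e' : Prop := inhabited (dcell L f g e e').

Definition acyclic (L : sqext) : Prop := forall Q : square,
  filled L (sq_top Q) (sq_bot Q) (sq_left Q) (sq_right Q).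

(* f *_i v and w *_i f for a cell v, resp. w, of C *)
Definition rcomp (P : pres C) (i : nat) (f : cell P) (v : C) : cell P :=
  pcomp i f (idc v).
Definition lcomp (P : pres C) (i : nat) (w : C) (f : cell P) : cell P :=
  pcomp i (idc w) f.

Definition is_peiffer (Q : square) : Prop :=
  exists (i : nat) (f : cell H) (e : cell V), i < n /\
  ([/\ cbd true i f = cbd false i e,
       sq_top Q = rcomp i f (src e), sq_bot Q = rcomp i f (tgt e),
       sq_left Q = lcomp i (src f) e & sq_right Q = lcomp i (tgt f) e] \/
   [/\ cbd true i e = cbd false i f,
       sq_top Q = lcomp i (src e) f, sq_bot Q = lcomp i (tgt e) f,
       sq_left Q = rcomp i e (src f) & sq_right Q = rcomp i e (tgt f)]).

Definition peiff : sqext := @SqExt {Q : square | is_peiffer Q} sval.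

End Squares.

(* -------------------------------------------------------------------------- *)
(** * Constructions on a polygraph modulo *)

Section Modulo.
Variables (n : nat) (P : polygraph_modulo n).

Definition base : ncat n := fcat (trunc (pm_R P)).

(* The rules of E, attached to R_{<= n}^* along the inclusion of E_{<= n}^*.
   E-rewriting takes place in R_{<= n}^*, i.e. E is used as the polygraph
   (R_{<= n}, E_{n+1}). *)
Definition E_ext : cellext base := push (restrict_incl (@E_sub n P)) (E_rules P).
Definition ERE : cellext base := ere E_ext (rules (pm_R P)).
Definition S_ext : cellext base := subext (@pm_S n P).

Definition R_star : pres base := free_pres (rules (pm_R P)).
Definition E_star : pres base := free_pres E_ext.
Definition E_top : pres base := free_inv_pres E_ext.
Definition S_star : pres base := Pres S_ext false (@triple_rel n base _ _ _).
Definition S_top : pres base := Pres S_ext true (@triple_rel n base _ _ _).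

Definition E_star_top (q : cell E_star) : cell E_top :=
  @pmap n base E_star E_top id q.
Definition S_star_top (q : cell S_star) : cell S_top :=
  @pmap n base S_star S_top id q.

Lemma cbd_E_star_top e i q : i <= n -> cbd e i (E_star_top q) = cbd e i q.
Proof. exact: (@cbd_pmap n base E_star E_top id). Qed.

Lemma cbd_S_star_top e i q : i <= n -> cbd e i (S_star_top q) = cbd e i q.
Proof.
by apply: (@cbd_pmap n base S_star S_top id) => // a b; rewrite !tmap_id.
Qed.

(* The rewriting step s of S^* is a whisker c[x] of a generator x of S, and
   c[x] = (e, f, e') as a triple. *)
Definition step_triple (e : cell E_top) (f : cell R_star) (e' : cell E_top)
    (s : cell S_star) : Prop :=
  exists (x : S_ext) (c : ctx base),
    [/\ whiskable c (genc (P := S_star) x),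
        s = whisk c (genc (P := S_star) x),
        e = whisk c (t_pre (sval x)),
        f = whisk c (t_mid (sval x)) &
        e' = whisk c (t_post (sval x))].

(* h is the cell e f of S^*: a first step (a, r, b) of f is replaced by
   (e *_n a, r, b), which must again be a rewriting step of S^*.  The identity
   acts on every cell, in particular on identities, which have no first step. *)
Definition precomp (e : cell E_top) (f h : cell S_star) : Prop :=
  tgt e = src f /\
  ((e = idc (src f) /\ h = f) \/
   exists (a b : cell E_top) (r : cell R_star) (s s' f' : cell S_star),
     [/\ step_triple a r b s, step_triple (e ** a) r b s',
         tgt s = src f', f = s ** f' & h = s' ** f']).

(* Q is the boundary of the square cell obtained by letting e1 and e2 act on a
   square cell of boundary A. *)
Definition biaction (e1 e2 : cell E_top) (A Q : square E_top S_star) : Prop :=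
  [/\ tgt e1 = src (sq_left A) /\ src e2 = tgt (sq_left A),
      precomp e1 (sq_top A) (sq_top Q),
      precomp (invc e2) (sq_bot A) (sq_bot Q),
      sq_left Q = e1 ** sq_left A ** e2 &
      sq_right Q = sq_right A].

Definition square_extension := sqext E_top S_star.

Section Gamma.
Variable G : square_extension.

Record rtimes_cell := RTimes {
  rt_cell : G;
  rt_e1 : cell E_top;
  rt_e2 : cell E_top;
  rt_bd : square E_top S_star;
  rt_ok : biaction rt_e1 rt_e2 (sqbd rt_cell) rt_bd }.

Definition rtimes : square_extension := SqExt rt_bd.

(* Generating squares of Gamma^curlyvee. *)
Definition curlyvee_gen : square_extension := squnion rtimes (peiff E_top S_star).

Definition branching_confluent (f : cell S_star) (e : cell E_top)
    (g : cell S_star) : Prop :=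
  exists (f' g' : cell S_star) (e' : cell E_top),
    [/\ tgt f = src f', tgt g = src g' &
        filled curlyvee_gen (f ** f') (g ** g') e e'].

Definition diconvergent : Prop :=
  [/\ terminating (extend ERE),
      (forall f e g, f <> idc (src f) -> src f = src e -> src g = tgt e ->
        branching_confluent f e g) &
      convergent (extend E_ext)].

End Gamma.

(* A normalization strategy, for X = E_star or S_star. *)
Record strategy (X : pres base) := Strategy {
  strat :> base -> cell X;
  strat_src : forall u, src (strat u) = u;
  strat_nf : forall u, normal_form X (tgt (strat u)) }.

Definition nf (X : pres base) (s : strategy X) (u : base) : base := tgt (s u).

Record weak_commutation (sigma : strategy S_star) (rho : strategy E_star) :=
  WeakCommutation {
    wcom :> base -> cell S_star;
    wcom_src : forall u, src (wcom u) = nf rho u;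
    wcom_tgt : forall u, tgt (wcom u) = nf rho (nf sigma u) }.

Lemma src_E_star_top q : src (E_star_top q) = src q.
Proof. exact: cbd_E_star_top. Qed.

Lemma tgt_E_star_top q : tgt (E_star_top q) = tgt q.
Proof. exact: cbd_E_star_top. Qed.

Lemma src_S_star_top q : src (S_star_top q) = src q.
Proof. exact: cbd_S_star_top. Qed.

Lemma tgt_S_star_top q : tgt (S_star_top q) = tgt q.
Proof. exact: cbd_S_star_top. Qed.

Section N.
Variables (sigma : strategy S_star) (rho : strategy E_star).
Variable eta : weak_commutation sigma rho.

Definition N_square (u : base) : square E_top S_star.
Proof.
refine (@Square n base E_top S_star (sigma u) (eta u) (E_star_top (rho u))
  (E_star_top (rho (nf sigma u))) _ _ _ _).
- by rewrite src_E_star_top !strat_src.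
- by rewrite src_E_star_top strat_src.
- by rewrite tgt_E_star_top wcom_src.
- by rewrite tgt_E_star_top wcom_tgt.
Defined.

Definition N_ext : square_extension := SqExt N_square.

End N.

Definition peiffer_branching (e e' : cell E_star) : Prop :=
  exists (i : nat) (d d' : cell E_star),
    [/\ i < n, cbd true i d = cbd false i d',
        e = rcomp i d (src d') & e' = lcomp i (src d) d'].

Definition local_branching (e e' : cell E_star) : Prop :=
  [/\ rewriting_step e, rewriting_step e' & src e = src e'].

(* Peiffer forms are excluded in both orders.  The last clause is minimality
   for the action of whiskers. *)
Definition critical (e e' : cell E_star) : Prop :=
  [/\ local_branching e e', e <> e',
      ~ peiffer_branching e e', ~ peiffer_branching e' e &
      forall (c : ctx base) d d', local_branching d d' -> whiskable c d ->
        whiskable c d' -> e = whisk c d -> e' = whisk c d' ->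
        d = e /\ d' = e'].

Record critical_branching := CriticalBranching {
  cb1 : cell E_star;
  cb2 : cell E_star;
  cb_critical : critical cb1 cb2 }.

Record confluence (b : critical_branching) := Confluence {
  cf1 : cell E_star;
  cf2 : cell E_star;
  cf_src1 : src cf1 = tgt (cb1 b);
  cf_src2 : src cf2 = tgt (cb2 b);
  cf_tgt : tgt cf1 = tgt cf2 }.

Lemma comp_bd (X : pres base) (p q : cell X) : tgt p = src q ->
  src (p ** q) = src p /\ tgt (p ** q) = tgt q.
Proof.
move=> h; have w : wf (Comp n (repr p) (repr q)).
  by apply: wf_comp => //; exact: repr_wf.
by rewrite /src /tgt /vcomp /pcomp !cbd_mk //= leqnn.
Qed.

(* The square extension S(E) determined by the chosen confluences kappa. *)
Definition SE_square (kappa : forall b, confluence b) (b : critical_branching) :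
    square E_top S_star.
Proof.
refine (@Square n base E_top S_star (idc (src (cb1 b))) (idc (tgt (cf1 (kappa b))))
  (E_star_top (cb1 b ** cf1 (kappa b))) (E_star_top (cb2 b ** cf2 (kappa b)))
  _ _ _ _); have [[_ _ hs] _ _ _ _] := cb_critical b;
  rewrite ?src_E_star_top ?tgt_E_star_top;
  have [s1 t1] := comp_bd (esym (cf_src1 (kappa b)));
  have [s2 t2] := comp_bd (esym (cf_src2 (kappa b)));
  rewrite ?src_idc ?tgt_idc ?s1 ?s2 ?t1 ?t2 //.
exact: cf_tgt.
Defined.

Definition SE_ext (kappa : forall b, confluence b) : square_extension :=
  SqExt (SE_square kappa).

Definition squier (G : square_extension) (kappa : forall b, confluence b) :
    square_extension :=
  squnion (squnion (rtimes G) (peiff E_top S_star)) (SE_ext kappa).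

(* A square extension of (E_top, S_star), viewed over (E_top, S_top). *)
Definition lift_square (Q : square E_top S_star) : square E_top S_top.
Proof.
refine (@Square n base E_top S_top (S_star_top (sq_top Q))
  (S_star_top (sq_bot Q)) (sq_left Q) (sq_right Q) _ _ _ _);
  rewrite ?src_S_star_top ?tgt_S_star_top.
- exact: sq_tl.
- exact: sq_tr.
- exact: sq_bl.
- exact: sq_br.
Defined.

Definition lift_ext (L : square_extension) : sqext E_top S_top :=
  SqExt (fun x : L => lift_square (sqbd x)).

Definition coherent (L : square_extension) : Prop := acyclic (lift_ext L).

End Modulo.

(* Main.v *)
(* For parallel cells e, e' of E^T, Squier's argument (Noetherian induction along
   E, with local branchings closed by whiskered cells of S(E) or by the exchange
   law) fills the square with identity top and bottom, left e and right e'. Hence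
   whether a square with top f and bottom g can be filled does not depend on its
   vertical sides; write f ~ g when it can. This relation is compatible with
   composition and inverses.
   Gamma-confluence of the branchings (f sigma_v, 1, sigma_u) and
   (sigma_u, e, sigma_v), whose ends are already S-normal forms, gives
   f sigma_v ~ sigma_u for f : u -> v in S^*, and sigma_u ~ sigma_v for
   e : u -> v in E^T. The targets of sigma_u and sigma_v are joined by an E-zigzag,
   so eta_u and eta_v have the same target, and N gives sigma_u ~ eta_u. Therefore
   f ~ f sigma_v sigma_v^- ~ eta_u eta_v^-, a relation that extends to all f in
   S^T by composing along a zigzag, and whose right-hand side depends, up to ~,
   only on the E-classes of u and v. *)
From mathcomp Require Import all_boot boolp.
Require Import Defs.

Set Implicit Arguments.
Unset Strict Implicit.
Unset Printing Implicit Defensive.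

(** * Contexts *)

Section Contexts.
Variables (n : nat) (D : ncat n).
Implicit Types (c : ctx D) (x y : D).

(** Same recursion as [twhisk], but evaluated in an arbitrary n-category instead of on formal
    composites, so that contexts can be composed and transported along functors. Keeping the level
    [j] as an argument permits induction on it. *)
Fixpoint cwhisk c (j : nat) x : D :=
  match j with
  | 0 => x
  | i.+1 => comp i (comp i (c i).1 (cwhisk c i x)) (c i).2
  end.

Fixpoint cwdef c (j : nat) x : Prop :=
  match j with
  | 0 => True
  | i.+1 => [/\ cwdef c i x, bd true i (c i).1 = bd false i (cwhisk c i x) &
                bd true i (cwhisk c i x) = bd false i (c i).2]
  end.

Definition ctxdim c (j : nat) : Prop := forall i, i < j ->
  bd false i.+1 (c i).1 = (c i).1 /\ bd false i.+1 (c i).2 = (c i).2.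

Lemma bd_le x i k e : bd false i x = x -> i <= k -> bd e k x = x.
Proof. by move=> <- ik; rewrite bd_bd ltnNge ik. Qed.

Lemma ctxdimW c i j : i <= j -> ctxdim c j -> ctxdim c i.
Proof. by move=> ij h k ki; apply: h; exact: leq_trans ij. Qed.

Lemma bd_cwhisk c j x e k : ctxdim c j -> cwdef c j x -> j <= k ->
  bd e k (cwhisk c j x) = cwhisk c j (bd e k x).
Proof.
elim: j => [|i IH] // hc [hx h1 h2] ik.
have [f1 f2] := hc i (ltnSn i).
have h3 : bd true i (comp i (c i).1 (cwhisk c i x)) = bd false i (c i).2.
  by rewrite bd_comp // leqnn.
have hcW := ctxdimW (leqnSn i) hc.
rewrite /= bd_comp // leqNgt ik /= bd_comp // leqNgt ik /=.
by rewrite (bd_le _ f1) // (bd_le _ f2) // IH // ltnW.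
Qed.

(** Level i composes along i-cells only, so definedness below level [j] sees nothing of the argument
    beyond its boundaries of dimension less than [j]. *)
Lemma cwdef_par c j x y : ctxdim c j ->
  (forall e i, i < j -> bd e i x = bd e i y) -> cwdef c j x -> cwdef c j y.
Proof.
elim: j => [|i IH] // hc h [hx h1 h2].
have hcW := ctxdimW (leqnSn i) hc.
have hy : cwdef c i y by apply: IH hx => // e k ki; apply: h; exact: leqW.
split=> //.
  by rewrite bd_cwhisk // -h // -bd_cwhisk.
by rewrite bd_cwhisk // -h // -bd_cwhisk.
Qed.

Lemma bd_par i x y : bd true i x = bd false i y ->
  forall e k, k < i -> bd e k x = bd e k y.
Proof. by move=> h e k ki; have := congr1 (bd e k) h; rewrite !bd_bd ki. Qed.

Lemma bd_comp_par i x y : bd true i x = bd false i y ->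
  forall e k, k < i -> bd e k (comp i x y) = bd e k x.
Proof.
move=> h e k ki; rewrite bd_comp // (ltnW ki).
by case: e => //; rewrite (bd_par h).
Qed.

(** Being an identity in dimension k, [f] equals its own composite with itself along k; the exchange
    law does the rest. *)
Lemma comp_whiskl i k f x y : i < k -> bd false i.+1 f = f ->
  bd true i f = bd false i x -> bd true k x = bd false k y ->
  comp i f (comp k x y) = comp k (comp i f x) (comp i f y).
Proof.
move=> ik hf hx hxy.
have fk e : bd e k f = f by exact: bd_le ik.
by rewrite -{1}[f](comp_idl k) fk comp_exch ?fk.
Qed.

Lemma comp_whiskr i k f x y : i < k -> bd false i.+1 f = f ->
  bd true i x = bd false i f -> bd true k x = bd false k y ->
  comp i (comp k x y) f = comp k (comp i x f) (comp i y f).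
Proof.
move=> ik hf hx hxy.
have fk e : bd e k f = f by exact: bd_le ik.
by rewrite -{1}[f](comp_idl k) fk comp_exch ?fk.
Qed.

Lemma cwhisk_comp c j k x y : ctxdim c j -> cwdef c j x -> j <= k ->
  bd true k x = bd false k y ->
  cwhisk c j (comp k x y) = comp k (cwhisk c j x) (cwhisk c j y).
Proof.
move=> hc hx jk h.
have: cwdef c j y.
  by apply: cwdef_par hx => // e i ij; apply: bd_par h _ _ _; exact: leq_trans jk.
elim: j hc hx jk => [|i IH] // hc [hx h1 h2] ik [hy h3 h4].
have [f1 f2] := hc i (ltnSn i).
have hcW := ctxdimW (leqnSn i) hc.
have hxy : bd true k (cwhisk c i x) = bd false k (cwhisk c i y).
  by rewrite !bd_cwhisk ?h // ltnW.
rewrite /= IH //; last exact: ltnW.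
rewrite comp_whiskl // comp_whiskr //; first by rewrite bd_comp // leqnn.
rewrite !bd_comp // leqNgt ik /=.
by rewrite !(bd_le _ f1) // hxy.
Qed.

(* The context c[c'[-]]: a level of c distributes over the composites of higher
   dimension, so at level j the cells of c' are whiskered by the levels < j of c. *)
Definition cctx c c' : ctx D := fun j =>
  (comp j (c j).1 (cwhisk c j (c' j).1), comp j (cwhisk c j (c' j).2) (c j).2).

(** One level of the nested whiskering: the levels of [c] below i distribute over the two
    i-composites that form level i of [c']. Definedness passes between the three factors because
    consecutive ones are parallel below dimension i. *)
Lemma cctx_level c c' i x : ctxdim c i.+1 -> ctxdim c' i.+1 ->
  cwdef c' i.+1 x -> cwdef c i.+1 (cwhisk c' i.+1 x) ->
  let f := (c' i).1 in let w := cwhisk c' i x in let g := (c' i).2 in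
  [/\ [/\ cwdef c i f, cwdef c i w & cwdef c i g],
      [/\ bd true i (c i).1 = bd false i (cwhisk c i f),
          bd true i (cwhisk c i f) = bd false i (cwhisk c i w),
          bd true i (cwhisk c i w) = bd false i (cwhisk c i g) &
          bd true i (cwhisk c i g) = bd false i (c i).2] &
      cwhisk c i (cwhisk c' i.+1 x) =
        comp i (comp i (cwhisk c i f) (cwhisk c i w)) (cwhisk c i g)].
Proof.
move=> hc hc' [hx h1 h2] [hy].
have hcW := ctxdimW (leqnSn i) hc.
have h3 : bd true i (comp i (c' i).1 (cwhisk c' i x)) = bd false i (c' i).2.
  by rewrite bd_comp // leqnn.
have hf : cwdef c i (c' i).1.
  apply: cwdef_par hy => // e k ki.
  by rewrite /= (bd_comp_par h3) // (bd_comp_par h1).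
have hw : cwdef c i (cwhisk c' i x).
  by apply: cwdef_par hf => // e k ki; exact: (bd_par h1).
have hg : cwdef c i (c' i).2.
  by apply: cwdef_par hw => // e k ki; exact: (bd_par h2).
have hfw : cwdef c i (comp i (c' i).1 (cwhisk c' i x)).
  by apply: cwdef_par hf => // e k ki; rewrite (bd_comp_par h1).
rewrite /= cwhisk_comp // cwhisk_comp //.
have b1 : bd true i (cwhisk c i (c' i).1) = bd false i (cwhisk c i (cwhisk c' i x)).
  by rewrite (bd_cwhisk _ hcW hf) // (bd_cwhisk _ hcW hw) // h1.
have b2 : bd true i (cwhisk c i (cwhisk c' i x)) = bd false i (cwhisk c i (c' i).2).
  by rewrite (bd_cwhisk _ hcW hw) // (bd_cwhisk _ hcW hg) // h2.
have b3 : bd true i (comp i (cwhisk c i (c' i).1) (cwhisk c i (cwhisk c' i x))) =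
    bd false i (cwhisk c i (c' i).2) by rewrite bd_comp // leqnn.
by rewrite (bd_comp _ _ b3) leqnn (bd_comp _ _ b1) leqnn (bd_comp _ _ b3) leqnn.
Qed.

Lemma cwhisk_cctx c c' j x : ctxdim c j -> ctxdim c' j -> cwdef c' j x ->
  cwdef c j (cwhisk c' j x) ->
  [/\ ctxdim (cctx c c') j, cwdef (cctx c c') j x &
      cwhisk (cctx c c') j x = cwhisk c j (cwhisk c' j x)].
Proof.
elim: j => [|i IH] // hc hc' hx hy.
have hcW := ctxdimW (leqnSn i) hc; have hcW' := ctxdimW (leqnSn i) hc'.
have [f1 f2] := hc i (ltnSn i); have [f1' f2'] := hc' i (ltnSn i).
have [[hf hw hg] [b1 b2 b3 b4] ew] := cctx_level hc hc' hx hy.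
have [hx' _ _] := hx; have [d1 d2 d3] := IH hcW hcW' hx' hw.
split.
- move=> k; rewrite ltnS leq_eqVlt => /orP[/eqP->|]; last exact: d1.
  by split; rewrite /cctx /= bd_comp // ltnn bd_cwhisk // ?f1 ?f2 ?f1' ?f2'.
- by split=> //; rewrite d3 /cctx /= bd_comp // leqnn.
- by rewrite [RHS]/= ew /= d3 !comp_assoc // ?bd_comp // ?leqnn.
Qed.

Lemma cwhisk_ext c c' j x : (forall i, i < j -> c i = c' i) ->
  cwhisk c j x = cwhisk c' j x /\ (cwdef c j x -> cwdef c' j x).
Proof.
elim: j => [|i IH] //= h; have [|-> h'] := IH.
  by move=> k ki; apply: h; exact: leqW.
by rewrite h //; split=> // -[/h' ? ? ?].
Qed.

(** A level i whose two cells have dimension at most i composes with units. *)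
Lemma cwhisk_degenerate c k j x : k <= j -> cwdef c j x ->
  (forall i, k <= i < j ->
    bd false i (c i).1 = (c i).1 /\ bd false i (c i).2 = (c i).2) ->
  cwhisk c j x = cwhisk c k x.
Proof.
move=> kj; elim: j kj => [|i IH]; first by rewrite leqn0 => /eqP->.
rewrite leq_eqVlt => /orP[/eqP->//|]; rewrite ltnS => ki [hx h1 h2] h.
rewrite -(IH ki hx); last by move=> l /andP[kl li]; apply: h; rewrite kl leqW.
have [|f1 f2] := h i; first by rewrite ki ltnSn.
rewrite /= -{1}(bd_le true f1 (leqnn i)) h1 comp_idl.
by rewrite -f2 -h2 comp_idr.
Qed.

End Contexts.

(** * Cells of presented categories *)

Section Cells.
Variables (n : nat) (C : ncat n) (P : pres C).
Implicit Types (p q r : cell P) (c d : C).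

Lemma pcompA i p q r : i <= n ->
  cbd true i p = cbd false i q -> cbd true i q = cbd false i r ->
  pcomp i (pcomp i p q) r = pcomp i p (pcomp i q r).
Proof.
by move=> hi h1 h2; apply: (@comp_assoc _ (pres_cat P)); apply/pbd_compat.
Qed.

Lemma cbd_pcomp e i j p q : i <= n -> j <= n -> cbd true i p = cbd false i q ->
  cbd e j (pcomp i p q) =
  if j <= i then cbd e j (if e then q else p) else comp i (cbd e j p) (cbd e j q).
Proof.
move=> hi hj h; rewrite cbd_mk //; last by apply: wf_pcomp => //; apply/pbd_compat.
by rewrite /=; case: ifP; case: e.
Qed.

Lemma pcomp_idl i p c : i <= n -> cbd false i p = c -> pcomp i (idc c) p = p.
Proof.
by move=> hi <-; have := @comp_idl _ (pres_cat P) i p; rewrite /= /pbd hi.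
Qed.

Lemma pcomp_idr i p c : i <= n -> cbd true i p = c -> pcomp i p (idc c) = p.
Proof.
by move=> hi <-; have := @comp_idr _ (pres_cat P) i p; rewrite /= /pbd hi.
Qed.

Lemma pcomp_exch i j p q r s : i < j -> j <= n ->
  cbd true j p = cbd false j q -> cbd true j r = cbd false j s ->
  cbd true i p = cbd false i r ->
  pcomp i (pcomp j p q) (pcomp j r s) = pcomp j (pcomp i p r) (pcomp i q s).
Proof.
move=> ij hj h1 h2 h3; apply: (@comp_exch _ (pres_cat P)) => //; apply/pbd_compat => //.
exact: leq_trans (ltnW ij) hj.
Qed.

Lemma pcomp_idc i c d : i <= n -> bd true i c = bd false i d ->
  pcomp i (idc c) (idc d) = idc (comp i c d) :> cell P.
Proof.
move=> hi h; have e := eqv_cel P hi h.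
have [w _ _] := eqv_props e.
rewrite (@pcomp_mk _ _ _ i (idc c) _ _ _ _ (repr_idc P c) (repr_idc P d)).
  by rewrite (mk_eq _ (idc c) e) mk_idc.
exact: wf_eqv_comp w (eqv_sym (repr_idc P c)) (eqv_sym (repr_idc P d)).
Qed.

Lemma wf_vcomp p q : tgt p = src q -> wf (Comp n (repr p) (repr q)).
Proof. by move=> h; apply: wf_pcomp => //; apply/pbd_compat. Qed.

Lemma src_vcomp p q : tgt p = src q -> src (p ** q) = src p.
Proof. by move=> h; rewrite /src cbd_pcomp // leqnn. Qed.

Lemma tgt_vcomp p q : tgt p = src q -> tgt (p ** q) = tgt q.
Proof. by move=> h; rewrite /tgt cbd_pcomp // leqnn. Qed.

Lemma vcompA p q r : tgt p = src q -> tgt q = src r -> p ** q ** r = p ** (q ** r).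
Proof. exact: pcompA. Qed.

Lemma vcomp_idl p c : src p = c -> idc c ** p = p.
Proof. exact: pcomp_idl. Qed.

Lemma vcomp_idr p c : tgt p = c -> p ** idc c = p.
Proof. exact: pcomp_idr. Qed.

Lemma cbd_src_tgt p e i : i < n ->
  bd e i (src p) = cbd e i p /\ bd e i (tgt p) = cbd e i p.
Proof. by move=> hi; rewrite /src /tgt !bd_cbd // hi. Qed.

Lemma cbd_composable p q e i : i < n -> tgt p = src q -> cbd e i p = cbd e i q.
Proof.
move=> hi h; have [_ <-] := cbd_src_tgt p e hi; have [<- _] := cbd_src_tgt q e hi.
by rewrite h.
Qed.

Lemma cbd_vcomp p q e i : i < n -> tgt p = src q -> cbd e i (p ** q) = cbd e i p.
Proof.
move=> hi h; rewrite cbd_pcomp // 1?ltnW //.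
by case: e => //; rewrite (cbd_composable _ hi h).
Qed.

(** Induction on a well-formed representative, carried to classes through [mk]. *)
Lemma cell_ind (F : cell P -> Prop) :
  (forall c, F (idc c)) -> (forall x, F (genc x)) ->
  (forall i p q, i <= n -> cbd true i p = cbd false i q -> F p -> F q ->
    F (pcomp i p q)) ->
  (forall q, pinv P -> F q -> F (invc q)) ->
  forall q, F q.
Proof.
move=> hid hgen hcomp hinv q; rewrite -(mk_repr q q).
have := repr_wf q; move: (repr q) => a; elim=> {a}
  [c|x|i a b ha IHa hb IHb hi h|a hi ha IHa].
- by rewrite mk_idc.
- have e := repr_genc x; have := hgen x; congr F.
  by rewrite -(mk_repr q (genc x)); exact: mk_eq.
- have w : wf (Comp i (repr (mk q a)) (repr (mk q b))).
    apply: wf_eqv_comp (wf_comp ha hb hi h) _ _; exact/eqv_sym/repr_mk.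
  rewrite -(pcomp_mk q (repr_mk q ha) (repr_mk q hb) w).
  by apply: hcomp => //; rewrite !cbd_mk.
- have := hinv _ hi IHa; congr F; apply: mk_eq.
  by apply: eqv_inv => //; exact: repr_mk.
Qed.

(** Padding the factors with identities and exchanging makes a low-dimensional composite sequential.
    [pcomp_whisk_swap] pads on the other sides; the two results together close Peiffer
    branchings. *)
Lemma pcomp_whisk i p q : i < n -> cbd true i p = cbd false i q ->
  pcomp i p q = rcomp i p (src q) ** lcomp i (tgt p) q.
Proof.
move=> hi h; have hi' := ltnW hi.
rewrite -[in LHS](@vcomp_idr p _ erefl) -[in LHS](@vcomp_idl q _ erefl).
rewrite /vcomp pcomp_exch //.
- by rewrite -/(src _) src_idc.
- by rewrite -/(tgt _) tgt_idc.
- by rewrite cbd_idc //; have [->] := cbd_src_tgt q false hi.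
Qed.

Lemma pcomp_whisk_swap i p q : i < n -> cbd true i p = cbd false i q ->
  pcomp i p q = lcomp i (src p) q ** rcomp i p (tgt q).
Proof.
move=> hi h; have hi' := ltnW hi.
rewrite -[in LHS](@vcomp_idl p _ erefl) -[in LHS](@vcomp_idr q _ erefl).
rewrite /vcomp pcomp_exch //.
- by rewrite -/(tgt _) tgt_idc.
- by rewrite -/(src _) src_idc.
- by rewrite cbd_idc //; have [->] := cbd_src_tgt p true hi.
Qed.

Lemma rcompD i p q v : i < n -> tgt p = src q -> cbd true i p = bd false i v ->
  rcomp i (p ** q) v = rcomp i p v ** rcomp i q v.
Proof.
move=> hi h hv.
rewrite /rcomp -[in LHS](@vcomp_idl (idc v) v) ?src_idc // /vcomp pcomp_exch //.
  by rewrite !cbd_idc // !bd_dim.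
by rewrite cbd_idc // ltnW.
Qed.

Lemma lcompD i p q v : i < n -> tgt p = src q -> bd true i v = cbd false i p ->
  lcomp i v (p ** q) = lcomp i v p ** lcomp i v q.
Proof.
move=> hi h hv.
rewrite /lcomp -[in LHS](@vcomp_idl (idc v) v) ?src_idc // /vcomp pcomp_exch //.
  by rewrite !cbd_idc // !bd_dim.
by rewrite cbd_idc // ltnW.
Qed.

Lemma src_rcomp i p v : i < n -> cbd true i p = bd false i v ->
  src (rcomp i p v) = comp i (src p) v.
Proof.
move=> hi h; rewrite /src /rcomp (cbd_pcomp _ (ltnW hi)) ?cbd_idc ?(ltnW hi) //.
by rewrite leqNgt hi /= bd_dim.
Qed.

Lemma tgt_rcomp i p v : i < n -> cbd true i p = bd false i v ->
  tgt (rcomp i p v) = comp i (tgt p) v.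
Proof.
move=> hi h; rewrite /tgt /rcomp (cbd_pcomp _ (ltnW hi)) ?cbd_idc ?(ltnW hi) //.
by rewrite leqNgt hi /= bd_dim.
Qed.

Lemma src_lcomp i p v : i < n -> bd true i v = cbd false i p ->
  src (lcomp i v p) = comp i v (src p).
Proof.
move=> hi h; rewrite /src /lcomp (cbd_pcomp _ (ltnW hi)) ?cbd_idc ?(ltnW hi) //.
by rewrite leqNgt hi /= bd_dim.
Qed.

Lemma tgt_lcomp i p v : i < n -> bd true i v = cbd false i p ->
  tgt (lcomp i v p) = comp i v (tgt p).
Proof.
move=> hi h; rewrite /tgt /lcomp (cbd_pcomp _ (ltnW hi)) ?cbd_idc ?(ltnW hi) //.
by rewrite leqNgt hi /= bd_dim.
Qed.

(** By [pcomp_whisk], composites along lower dimensions are needed only against cells of [C], that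
    is, as whiskers. *)
Lemma vcell_ind (F : cell P -> Prop) :
  (forall c, F (idc c)) -> (forall x, F (genc x)) ->
  (forall p q, tgt p = src q -> F p -> F q -> F (p ** q)) ->
  (forall q, pinv P -> F q -> F (invc q)) ->
  (forall i p v, i < n -> cbd true i p = bd false i v -> F p -> F (rcomp i p v)) ->
  (forall i p v, i < n -> bd true i v = cbd false i p -> F p -> F (lcomp i v p)) ->
  forall q, F q.
Proof.
move=> hid hgen hcomp hinv hr hl; apply: cell_ind => // i p q.
rewrite leq_eqVlt => /orP[/eqP->|hi] h; first exact: hcomp.
have e1 : cbd true i p = bd false i (src q) by have [->] := cbd_src_tgt q false hi.
have e2 : bd true i (tgt p) = cbd false i q by have [_ ->] := cbd_src_tgt p true hi.
move=> hp hq; rewrite pcomp_whisk //; apply: hcomp; [|exact: hr|exact: hl].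
by rewrite tgt_rcomp // src_lcomp.
Qed.

Section Inverse.
Hypothesis hinv : pinv P.

Lemma cbd_invc e i q : i <= n -> cbd e i (invc q) = cbd (if i < n then e else ~~ e) i q.
Proof. by move=> hi; rewrite cbd_mk //; apply: wf_inv => //; exact: repr_wf. Qed.

Lemma src_invc q : src (invc q) = tgt q.
Proof. by rewrite /src cbd_invc // ltnn. Qed.

Lemma tgt_invc q : tgt (invc q) = src q.
Proof. by rewrite /tgt cbd_invc // ltnn. Qed.

Lemma repr_invc q : eqv (repr (invc q)) (Inv (repr q)).
Proof. by apply: repr_mk; apply: wf_inv => //; exact: repr_wf. Qed.

Lemma vcomp_invr q : q ** invc q = idc (src q).
Proof.
have w := wf_vcomp (esym (src_invc q)).
rewrite /vcomp (pcomp_mk q (eqv_refl (repr_wf q)) (repr_invc q) w).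
by rewrite (mk_eq q q (eqv_invr hinv (repr_wf q))) mk_idc.
Qed.

Lemma vcomp_invl q : invc q ** q = idc (tgt q).
Proof.
have w := wf_vcomp (tgt_invc q).
rewrite /vcomp (pcomp_mk q (repr_invc q) (eqv_refl (repr_wf q)) w).
by rewrite (mk_eq q q (eqv_invl hinv (repr_wf q))) mk_idc.
Qed.

Lemma invc_unique p q : tgt p = src q -> p ** q = idc (src p) -> q = invc p.
Proof.
move=> h e; have ht : tgt q = src p by rewrite -(tgt_vcomp h) e tgt_idc.
rewrite -(@vcomp_idl q (src q)) // -h -vcomp_invl vcompA ?tgt_invc // e.
by rewrite vcomp_idr // tgt_invc.
Qed.

Lemma invcK q : invc (invc q) = q.
Proof.
by apply/esym/invc_unique; rewrite ?tgt_invc // vcomp_invl src_invc.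
Qed.

Lemma invc_idc c : invc (idc c) = idc c :> cell P.
Proof.
by apply/esym/invc_unique; rewrite ?tgt_idc ?src_idc // vcomp_idl ?src_idc.
Qed.

Lemma invc_vcomp p q : tgt p = src q -> invc (p ** q) = invc q ** invc p.
Proof.
move=> h; have h' : tgt (invc q) = src (invc p) by rewrite tgt_invc src_invc.
apply/esym/invc_unique; first by rewrite src_vcomp // tgt_vcomp // src_invc.
rewrite (src_vcomp h) vcompA //; last by rewrite src_vcomp // src_invc.
rewrite -(@vcompA q) //; last by rewrite src_invc.
by rewrite vcomp_invr -h vcomp_idl ?src_invc // vcomp_invr.
Qed.

Lemma rcomp_invc i p v : i < n -> cbd true i p = bd false i v ->
  rcomp i (invc p) v = invc (rcomp i p v).
Proof.
move=> hi h; have h' : cbd true i (invc p) = bd false i v by rewrite cbd_invc ?hi // ltnW.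
apply: invc_unique; first by rewrite tgt_rcomp // src_rcomp // src_invc.
rewrite -rcompD ?src_invc // vcomp_invr src_rcomp // /rcomp pcomp_idc //.
  exact: ltnW.
by have [->] := cbd_src_tgt p true hi.
Qed.

Lemma lcomp_invc i p v : i < n -> bd true i v = cbd false i p ->
  lcomp i v (invc p) = invc (lcomp i v p).
Proof.
move=> hi h; have h' : bd true i v = cbd false i (invc p) by rewrite cbd_invc ?hi // ltnW.
apply: invc_unique; first by rewrite tgt_lcomp // src_lcomp // src_invc.
rewrite -lcompD ?src_invc // vcomp_invr src_lcomp // /lcomp pcomp_idc //.
  exact: ltnW.
by have [->] := cbd_src_tgt p false hi.
Qed.

End Inverse.

End Cells.

(** * Contexts along functors and whiskered cells *)

Section FunctorContexts.
Variables (n m : nat) (C : ncat n) (D : ncat m) (F : functor C D).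

Definition fctx (c : ctx C) : ctx D := fun j => (F (c j).1, F (c j).2).

Lemma fctxdim c j : ctxdim c j -> ctxdim (fctx c) j.
Proof. by move=> h i /h[h1 h2]; rewrite /= -!fmap_bd h1 h2. Qed.

Lemma fmap_cwhisk c j x : cwdef c j x ->
  F (cwhisk c j x) = cwhisk (fctx c) j (F x) /\ cwdef (fctx c) j (F x).
Proof.
elim: j => [|i IH] // [/IH[e h] h1 h2].
rewrite /= !fmap_comp //; last by rewrite bd_comp // leqnn.
by rewrite -e -!fmap_bd h1 h2.
Qed.

Lemma cwdef_fmap c j x : injective F -> cwdef (fctx c) j (F x) -> cwdef c j x.
Proof.
move=> hF; elim: j => [|i IH] // [/IH h h1 h2]; have [e _] := fmap_cwhisk h.
by split=> //; apply: hF; rewrite !fmap_bd e.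
Qed.

(** A functor preserves only composites that are defined, whence the comparison level by level,
    below [j], and under the assumption that the nested whiskering makes sense. *)
Lemma fctx_cctx c c' j x : ctxdim c j -> ctxdim c' j -> cwdef c' j x ->
  cwdef c j (cwhisk c' j x) ->
  forall i, i < j -> fctx (cctx c c') i = cctx (fctx c) (fctx c') i.
Proof.
elim: j => [|j IH] // hc hc' hx hy i.
have [[hf hw hg] [b1 b2 b3 b4] _] := cctx_level hc hc' hx hy.
rewrite ltnS leq_eqVlt => /orP[/eqP->|]; last first.
  by apply: IH => //; [exact: ctxdimW hc|exact: ctxdimW hc'|case: hx].
rewrite /fctx /cctx /= !fmap_comp //.
by have [-> _] := fmap_cwhisk hf; have [-> _] := fmap_cwhisk hg.
Qed.

End FunctorContexts.

Lemma comp_hi (n : nat) (C : ncat n) i (x y : C) : n <= i ->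
  bd true i x = bd false i y -> comp i x y = x.
Proof.
by move=> ni; rewrite !bd_dim // => ->; rewrite -{1}(bd_dim false y ni) comp_idl.
Qed.

Section WhiskCells.
Variables (n : nat) (C : ncat n).

(** Through this embedding a context of [C] becomes a context of the presented category, and
    whiskering a cell becomes an instance of [cwhisk]. *)
Definition id_functor (P : pres C) : functor C (pres_cat P).
Proof.
refine (@Functor n n.+1 C (pres_cat P) (@idc n C P) _ _).
- move=> e i x; rewrite /= /pbd; case: leqP => hi; first by rewrite cbd_idc.
  by rewrite bd_dim // ltnW.
- move=> i x y h; case: (leqP i n) => hi; first by rewrite /= pcomp_idc.
  by rewrite /= pcomp_hi // comp_hi // ltnW.
Defined.

Notation liftc P := (fctx (id_functor P)).

(** Formal whiskering of a representative matches [cwhisk] on classes. Both claims go in one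
    induction: composability at the next level reads boundaries of the inner term, which the
    equivalence carries over to the class. *)
Lemma wf_twhisk (P : pres C) c j (q : cell P) : j <= n ->
  (cwdef (liftc P c) j q <-> wf (twhisk c j (repr q) : term (pgen P))) /\
  (cwdef (liftc P c) j q ->
    eqv (repr (cwhisk (liftc P c) j q : cell P)) (twhisk c j (repr q))).
Proof.
elim: j => [|i IH] hi /=.
  by split=> [|_]; [split=> // _; exact: repr_wf|exact/eqv_refl/repr_wf].
have [IH1 IH2] := IH (ltnW hi); have hi' := ltnW hi.
set t := twhisk c i (repr q); set w := cwhisk (liftc P c) i q.
have ct : cwdef (liftc P c) i q -> forall e, cbd e i (w : cell P) = tbd e i t.
  by move=> /IH2 /eqv_props[_ _ h] e; exact: h.
have key : cwdef (liftc P c) i.+1 q ->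
    wf (Comp i (Comp i (Cel (c i).1) t) (Cel (c i).2)) /\
    eqv (repr (pcomp i (pcomp i (idc (c i).1) (w : cell P)) (idc (c i).2)))
      (Comp i (Comp i (Cel (c i).1) t) (Cel (c i).2)).
  move=> [hw /(pbd_compat _ _ hi') h1 /(pbd_compat _ _ hi') h2].
  have hW := IH2 hw; have [_ wt _] := eqv_props hW.
  have w1 : wf (Comp i (Cel (c i).1) t).
    apply: wf_comp => //; first exact: wf_cel.
    by rewrite -ct // -h1 cbd_idc.
  have w2 : wf (Comp i (Comp i (Cel (c i).1) t) (Cel (c i).2)).
    apply: wf_comp => //; first exact: wf_cel.
    by rewrite /= leqnn -ct // h2 cbd_idc.
  split=> //.
  have e1 : eqv (repr (pcomp i (idc (c i).1) (w : cell P))) (Comp i (Cel (c i).1) t).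
    have w0 := wf_eqv_comp w1 (eqv_sym (repr_idc _ _)) (eqv_sym hW).
    exact: eqv_trans (repr_pcomp w0) (eqv_comp w0 (repr_idc _ _) hW).
  have w3 := wf_eqv_comp w2 (eqv_sym e1) (eqv_sym (repr_idc _ _)).
  exact: eqv_trans (repr_pcomp w3) (eqv_comp w3 e1 (repr_idc _ _)).
split; last by move=> /key[].
split=> [/key[]//|].
move=> /wf_compE[/wf_compE[_ wt _ h1] _ _]; rewrite /= leqnn => h2.
have hw := (IH1.2 wt); split=> //; apply/pbd_compat => //=.
  by rewrite cbd_idc // ct //; exact: h1.
by rewrite cbd_idc // ct.
Qed.

Lemma whiskE (P : pres C) c (q : cell P) : whiskable c q ->
  whisk c q = cwhisk (liftc P c) n q.
Proof.
move=> [_ w]; have [h1 h2] := @wf_twhisk P c n q (leqnn n).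
by rewrite -[RHS](mk_repr q (cwhisk (liftc P c) n q : cell P)); apply/mk_eq/eqv_sym/h2/h1.
Qed.

Lemma idc_src_par (P : pres C) (q : cell P) e i : i < n ->
  bd e i (idc (src q) : pres_cat P) = bd e i (q : pres_cat P).
Proof.
move=> hi; rewrite /= /pbd (ltnW hi) cbd_idc 1?ltnW //.
by have [->] := cbd_src_tgt q e hi.
Qed.

(** The identity on the source of [q] is parallel to [q] below dimension n, and [idc] is injective,
    so the condition can be tested inside [C]. *)
Lemma whiskableE (P : pres C) c (q : cell P) :
  whiskable c q <-> ctxdim c n /\ cwdef c n (src q).
Proof.
have [h _] := @wf_twhisk P c n q (leqnn n).
split=> -[hc].
- move=> /h hq; split=> //; apply: (@cwdef_fmap _ _ _ _ (id_functor P)).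
    exact: idc_inj.
  apply: cwdef_par hq; first exact: fctxdim.
  by move=> e i hi; rewrite idc_src_par.
- move=> hq; split=> //; apply/h.
  have [_ h'] := fmap_cwhisk (id_functor P) hq.
  apply: cwdef_par h'; first exact: fctxdim.
  by move=> e i hi; exact: idc_src_par.
Qed.

Lemma whiskable_cwdef (P : pres C) c (q : cell P) : whiskable c q ->
  ctxdim (liftc P c) n /\ cwdef (liftc P c) n q.
Proof.
move=> [hc /(@wf_twhisk P c n q (leqnn n)).1 hq]; split=> //.
exact: fctxdim.
Qed.

Lemma whiskable_par (P Q : pres C) c (p : cell P) (q : cell Q) :
  (forall e i, i < n -> cbd e i p = cbd e i q) -> whiskable c p -> whiskable c q.
Proof.
move=> h /whiskableE[hc hp]; apply/whiskableE; split=> //.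
apply: cwdef_par hp => // e i hi.
by have [-> _] := cbd_src_tgt p e hi; have [-> _] := cbd_src_tgt q e hi; exact: h.
Qed.

Lemma whiskable_src (P Q : pres C) c (p : cell P) (q : cell Q) :
  src p = src q -> whiskable c p -> whiskable c q.
Proof. by move=> h /whiskableE; rewrite h => /whiskableE. Qed.

Lemma whiskable_comp (P Q : pres C) c (p : cell P) (q : cell Q) :
  tgt p = src q -> whiskable c p -> whiskable c q.
Proof.
move=> h; apply: whiskable_par => e i hi.
by have [_ <-] := cbd_src_tgt p e hi; have [<- _] := cbd_src_tgt q e hi; rewrite h.
Qed.

Lemma cbd_whisk (P : pres C) c e (q : cell P) : whiskable c q ->
  cbd e n (whisk c q) = cwhisk c n (cbd e n q).
Proof.
move=> hq; have [hc hd] := whiskable_cwdef hq; rewrite whiskE //.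
have := bd_cwhisk e hc hd (leqnn n); rewrite /= /pbd leqnn => h.
have hd' : cwdef c n (cbd e n q).
  have [hc' hd'] := (whiskableE c q).1 hq; apply: cwdef_par hd' => // d i hi.
  rewrite (proj1 (cbd_src_tgt q d hi)); case: e {h}.
    by rewrite (proj2 (cbd_src_tgt q d hi)).
  by rewrite (proj1 (cbd_src_tgt q d hi)).
have [h' _] := fmap_cwhisk (id_functor P) hd'.
by apply: (@idc_inj n C P); rewrite h; exact: esym h'.
Qed.

Lemma src_whisk (P : pres C) c (q : cell P) : whiskable c q ->
  src (whisk c q) = cwhisk c n (src q).
Proof. exact: cbd_whisk. Qed.

Lemma tgt_whisk (P : pres C) c (q : cell P) : whiskable c q ->
  tgt (whisk c q) = cwhisk c n (tgt q).
Proof. exact: cbd_whisk. Qed.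

Lemma whisk_idc (P : pres C) c x : whiskable c (idc x : cell P) ->
  whisk c (idc x) = idc (cwhisk c n x) :> cell P.
Proof.
move=> hx; rewrite whiskE //; have [_] := (whiskableE _ _).1 hx.
by rewrite src_idc => /(fmap_cwhisk (id_functor P))[].
Qed.

Lemma whisk_vcomp (P : pres C) c (p q : cell P) : whiskable c p ->
  tgt p = src q -> whisk c (p ** q) = whisk c p ** whisk c q.
Proof.
move=> hp h; have [hc hd] := whiskable_cwdef hp.
have hq := whiskable_comp h hp.
have hpq : whiskable c (p ** q) by apply: whiskable_src hp; rewrite src_vcomp.
rewrite !whiskE //; apply: (cwhisk_comp hc hd (leqnn n)).
exact/pbd_compat.
Qed.

Lemma whisk_cctx (P : pres C) c c' (q : cell P) :
  whiskable c' q -> whiskable c (whisk c' q) ->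
  whiskable (cctx c c') q /\ whisk (cctx c c') q = whisk c (whisk c' q).
Proof.
move=> h' h; have [hc' hd'] := (whiskableE _ _).1 h'.
have [hc hd] := (whiskableE _ _).1 h; rewrite src_whisk // in hd.
have [Hc Hd _] := cwhisk_cctx hc hc' hd' hd.
have H : whiskable (cctx c c') q by exact/whiskableE.
split=> //; rewrite (whiskE H) (whiskE h) (whiskE h').
have [kc' kd'] := whiskable_cwdef h'.
have [kc] := whiskable_cwdef h; rewrite {1}whiskE // => kd.
have [_ _ <-] := cwhisk_cctx kc kc' kd' kd.
exact: (proj1 (cwhisk_ext _ (fctx_cctx (id_functor P) hc hc' hd' hd))).
Qed.

Lemma whisk_degenerate (P : pres C) c (q : cell P) : whiskable c q ->
  (forall i, i < n -> bd false i (c i).1 = (c i).1 /\ bd false i (c i).2 = (c i).2) ->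
  whisk c q = q.
Proof.
move=> hq h; have [_ hd] := whiskable_cwdef hq; rewrite whiskE //.
apply: (cwhisk_degenerate (leq0n n) hd) => i /= hi; have [h1 h2] := h i hi.
by rewrite /pbd (ltnW hi) !cbd_idc ?h1 ?h2 // ltnW.
Qed.

End WhiskCells.

(** * Zigzags *)

Section Localisation.
Variables (n : nat) (C : ncat n) (X : cellext C) (R : term X -> term X -> Prop).

Notation star := (Pres X false R).
Notation top := (Pres X true R).
Notation loc := (@pmap n C star top id).

Let id_bd : forall e (x : X), gbd e (id x) = gbd e x. Proof. by []. Qed.
Let id_inv : pinv star -> pinv top. Proof. by []. Qed.
Let id_rel (a b : term X) : R a b -> R (tmap id a) (tmap id b).
Proof. by rewrite !tmap_id. Qed.

Lemma cbd_loc e i (q : cell star) : i <= n -> cbd e i (loc q) = cbd e i q.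
Proof. exact: (@cbd_pmap n C star top id). Qed.

Lemma src_loc (q : cell star) : src (loc q) = src q.
Proof. exact: cbd_loc. Qed.

Lemma tgt_loc (q : cell star) : tgt (loc q) = tgt q.
Proof. exact: cbd_loc. Qed.

Lemma loc_idc c : loc (idc c) = idc c.
Proof. exact: (@pmap_idc n C star top id). Qed.

Lemma loc_genc x : loc (genc x) = @genc n C top x.
Proof.
rewrite -[RHS](mk_repr (@genc n C top x)); apply: mk_eq.
apply: eqv_trans (eqv_sym (@repr_genc n C top x)).
by have := (@eqv_tmap n C star top id id_bd id_inv id_rel) _ _ (repr_genc x).
Qed.

Notation locF := (@pres_functor n C star top id id_bd id_inv id_rel).

Lemma loc_pcomp i (p q : cell star) : i <= n -> cbd true i p = cbd false i q ->
  loc (pcomp i p q) = pcomp i (loc p) (loc q).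
Proof. by move=> hi h; apply: (fmap_comp locF); apply/pbd_compat. Qed.

Lemma loc_vcomp (p q : cell star) : tgt p = src q -> loc (p ** q) = loc p ** loc q.
Proof. exact: loc_pcomp. Qed.

Lemma whiskable_loc c (q : cell star) : whiskable c (loc q) <-> whiskable c q.
Proof. by split; apply: whiskable_src; rewrite src_loc. Qed.

Lemma loc_whisk c (q : cell star) : whiskable c q ->
  loc (whisk c q) = whisk c (loc q).
Proof.
move=> h; have h' := (whiskable_loc c q).2 h.
rewrite (whiskE h) (whiskE h'); have [_ hd] := whiskable_cwdef h.
have [e _] := fmap_cwhisk locF hd; apply: (etrans e).
apply: (proj1 (cwhisk_ext _ _)) => i _.
by congr pair; exact: loc_idc.
Qed.

Inductive zigzag : cell top -> Prop :=
| zigzag_loc q : zigzag (loc q)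
| zigzag_inv q : zigzag (invc (loc q))
| zigzag_comp p q : tgt p = src q -> zigzag p -> zigzag q -> zigzag (p ** q).

(** Inverses reverse vertical composites and commute with whiskers, so they can be pushed inwards
    until they stand on images of cells of the category without inverses. *)
Lemma zigzag_all q : zigzag q.
Proof.
elim/vcell_ind: q => [c|x|p q h|q _ h|i p v hi h hp|i p v hi h hp].
- by rewrite -loc_idc; exact: zigzag_loc.
- by rewrite -loc_genc; exact: zigzag_loc.
- exact: zigzag_comp.
- elim: h => {q} [q|q|p q h _ hp _ hq].
  + exact: zigzag_inv.
  + by rewrite invcK //; exact: zigzag_loc.
  + rewrite invc_vcomp //; apply: zigzag_comp => //.
    by rewrite tgt_invc // src_invc.
- have hi' := ltnW hi; elim: hp h => {p} [q|q|p q h _ hp _ hq] hv.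
  + rewrite cbd_loc // in hv.
    by rewrite /rcomp -loc_idc -loc_pcomp ?cbd_idc //; exact: zigzag_loc.
  + rewrite cbd_invc // hi in hv; rewrite rcomp_invc //.
    rewrite cbd_loc // in hv.
    by rewrite /rcomp -loc_idc -loc_pcomp ?cbd_idc //; exact: zigzag_inv.
  + rewrite cbd_vcomp // in hv.
    have hv' : cbd true i q = bd false i v by rewrite -(cbd_composable _ hi h).
    rewrite rcompD //; apply: zigzag_comp; [|exact: hp|exact: hq].
    by rewrite tgt_rcomp // src_rcomp // h.
- have hi' := ltnW hi; elim: hp h => {p} [q|q|p q h _ hp _ hq] hv.
  + rewrite cbd_loc // in hv.
    by rewrite /lcomp -loc_idc -loc_pcomp ?cbd_idc //; exact: zigzag_loc.
  + rewrite cbd_invc // hi in hv; rewrite lcomp_invc //.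
    rewrite cbd_loc // in hv.
    by rewrite /lcomp -loc_idc -loc_pcomp ?cbd_idc //; exact: zigzag_inv.
  + rewrite cbd_vcomp // in hv.
    have hv' : bd true i v = cbd false i q by rewrite -(cbd_composable _ hi h).
    rewrite lcompD //; apply: zigzag_comp; [|exact: hp|exact: hq].
    by rewrite tgt_lcomp // src_lcomp // h.
Qed.


(** Inversion swaps the two [N] factors, and in a composite the two middle ones cancel. The relation
    is left abstract because this serves twice: with [esim] for E and with [hsim] for S. *)
Lemma zigzag_telescope (sim : cell top -> cell top -> Prop) (N : C -> cell top) :
  (forall p q p' q', tgt p = src q -> tgt p' = src q' ->
    sim p p' -> sim q q' -> sim (p ** q) (p' ** q')) ->
  (forall p q, sim p q -> sim (invc p) (invc q)) ->
  (forall q : cell star, tgt (N (src q)) = tgt (N (tgt q)) /\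
    sim (loc q) (N (src q) ** invc (N (tgt q)))) ->
  forall q : cell top, tgt (N (src q)) = tgt (N (tgt q)) /\
    sim q (N (src q) ** invc (N (tgt q))).
Proof.
move=> sim_comp sim_inv star q; have hI : pinv top by [].
have comp_inv u v : tgt (N u) = tgt (N v) -> tgt (N u) = src (invc (N v)).
  by rewrite src_invc.
elim: (zigzag_all q) => {q} [q|q|p q h _ [np hp] _ [nq hq]].
- by rewrite src_loc tgt_loc.
- have [hn h] := star q; rewrite src_invc // tgt_invc // src_loc tgt_loc.
  split; first by [].
  have := sim_inv _ _ h; rewrite invc_vcomp ?invcK //.
  exact: comp_inv.
- rewrite src_vcomp // tgt_vcomp //; split; first by rewrite np h.
  have cp := comp_inv _ _ np; have cq := comp_inv _ _ nq.
  have hc : tgt (N (src p) ** invc (N (tgt p))) = src (N (src q) ** invc (N (tgt q))).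
    by rewrite tgt_vcomp // src_vcomp // tgt_invc // h.
  have := sim_comp _ _ _ _ h hc hp hq; rewrite h in cp *.
  rewrite vcompA //; last by rewrite tgt_invc // src_vcomp.
  rewrite -(@vcompA _ _ _ (invc (N (src q)))) //; last by rewrite tgt_invc.
  by rewrite vcomp_invl // vcomp_idl // src_invc // nq.
Qed.

End Localisation.

(** * Size and first rewriting steps *)

Section Size.
Variables (n : nat) (C : ncat n) (P : pres C).
Hypothesis hP : pinv P = false.
Hypothesis hsize : forall a b : term (pgen P), prel a b -> tsize a = tsize b.

Lemma csize_mk (d : cell P) a : wf a -> csize (mk d a) = tsize a.
Proof. by move=> h; apply: eqv_size hP hsize (repr_mk d h). Qed.

Lemma csize_idc c : csize (idc c : cell P) = 0.
Proof. by rewrite -(mk_idc (idc c)) csize_mk //; exact: wf_cel. Qed.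

Lemma csize_genc x : csize (genc x : cell P) = 1.
Proof. exact: eqv_size hP hsize (repr_genc x). Qed.

Lemma csize_pcomp i (p q : cell P) : i <= n -> cbd true i p = cbd false i q ->
  csize (pcomp i p q) = csize p + csize q.
Proof.
by move=> hi h; rewrite csize_mk //; apply: wf_pcomp => //; apply/pbd_compat.
Qed.

Lemma csize0 (q : cell P) : csize q = 0 -> q = idc (src q).
Proof.
suff h (a : term (pgen P)) : wf a -> tsize a = 0 -> eqv a (Cel (tbd false n a)).
  move=> /(h _ (repr_wf q)) e.
  by rewrite -{1}(mk_repr (idc (src q)) q) (mk_eq _ (idc (src q)) e) mk_idc.
elim=> {a} [c|x|i a b ha IHa hb IHb hi h|a hi] //=.
- by move=> _; rewrite bd_dim //; exact/eqv_refl/wf_cel.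
- move=> /eqP; rewrite addn_eq0 => /andP[/eqP/IHa ea /eqP/IHb eb].
  have [_ _ ha'] := eqv_props ea; have [_ _ hb'] := eqv_props eb.
  have w := wf_comp ha hb hi h.
  apply: eqv_trans (eqv_comp w ea eb) _.
  have hc : bd true i (tbd false n a) = bd false i (tbd false n b).
    by rewrite -[LHS](ha' true i hi) -[RHS](hb' false i hi).
  (* The two branches agree when i = n, since composing n-cells along dimension n returns the first
     one. *)
  suff -> : (if n <= i then tbd false n a else comp i (tbd false n a) (tbd false n b))
    = comp i (tbd false n a) (tbd false n b) by exact: eqv_cel.
  by case: ifP => // ni; rewrite comp_hi.
- by rewrite hP in hi.
Qed.

(** Whiskers distribute over vertical composition and preserve size, so a first step of a whiskered
    cell is the whiskered first step. *)
Lemma first_step (q : cell P) : q = idc (src q) \/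
  exists s r : cell P, [/\ rewriting_step s, tgt s = src r & q = s ** r].
Proof.
elim/vcell_ind: q => [c|x|p q h hp hq|q|i p v hi h hp|i p v hi h hp].
- by left; rewrite src_idc.
- right; exists (genc x), (idc (tgt (genc x))); rewrite src_idc vcomp_idr //.
  by split=> //; exact: csize_genc.
- case: hp => [ep|[s [r [hs hr ep]]]].
    suff -> : p ** q = q by [].
    by rewrite ep vcomp_idl // -h ep tgt_idc src_idc.
  have hrq : tgt r = src q by rewrite -h ep tgt_vcomp.
  right; exists s, (r ** q); split=> //; first by rewrite src_vcomp.
  by rewrite ep vcompA.
- by rewrite hP.
- have hi' := ltnW hi; case: hp => [ep|[s [r [hs hr ep]]]]; [left|right].
    rewrite src_rcomp // {1}ep /rcomp pcomp_idc //.
    by rewrite -h; have [->] := cbd_src_tgt p true hi.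
  have h1 : cbd true i s = bd false i v by rewrite -h ep cbd_vcomp.
  have h2 : cbd true i r = bd false i v by rewrite -(cbd_composable _ hi hr).
  exists (rcomp i s v), (rcomp i r v); split.
  + by rewrite /rewriting_step csize_pcomp ?cbd_idc // csize_idc addn0.
  + by rewrite tgt_rcomp // src_rcomp // hr.
  + by rewrite ep rcompD.
- have hi' := ltnW hi; case: hp => [ep|[s [r [hs hr ep]]]]; [left|right].
    rewrite src_lcomp // {1}ep /lcomp pcomp_idc //.
    by rewrite h; have [->] := cbd_src_tgt p false hi.
  have h1 : bd true i v = cbd false i s by rewrite h ep cbd_vcomp.
  have h2 : bd true i v = cbd false i r by rewrite -(cbd_composable _ hi hr).
  exists (lcomp i v s), (lcomp i v r); split.
  + by rewrite /rewriting_step csize_pcomp ?cbd_idc // csize_idc.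
  + by rewrite tgt_lcomp // src_lcomp // hr.
  + by rewrite ep lcompD.
Qed.

Lemma normal_form_idc (q : cell P) : normal_form P (src q) -> q = idc (src q).
Proof.
move=> h; case: (first_step q) => // -[s [r [hs hr e]]].
by case: (h s hs); rewrite e src_vcomp.
Qed.

End Size.

(** * Weights of contexts *)

(* The weight of x in dimension k is the number of k-generators in its
   k-source; the junk value for k = 0 or k > n is never used. *)
Fixpoint weight (n : nat) : forall Q : polygraph n, nat -> fcat Q -> nat :=
  match n with
  | 0 => fun _ _ _ => 0
  | m.+1 => fun Q k x =>
      let q : cell (free_pres (rules Q)) := x in
      if k == m.+1 then csize q else weight (Q := trunc Q) k (src q)
  end.

Arguments weight {n Q} k x.

Lemma weight_comp (n : nat) (Q : polygraph n) i k (x y : fcat Q) :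
  i < k <= n -> bd true i x = bd false i y ->
  weight k (comp i x y) = weight k x + weight k y.
Proof.
elim: n Q k x y => [|m IH] Q k x y //= /andP[ik km].
have im : i <= m by rewrite -ltnS; exact: leq_trans km.
move=> /(pbd_compat _ _ im) h; case: eqP => [ek|/eqP nk].
  exact: csize_pcomp.
have {}km : k <= m by rewrite -ltnS ltn_neqAle nk.
have {}im : i < m by exact: leq_trans km.
rewrite /src (cbd_pcomp _ (ltnW im)) // leqNgt im IH //; first by rewrite ik.
by rewrite (proj1 (cbd_src_tgt x true im)) (proj1 (cbd_src_tgt y false im)).
Qed.

Lemma weight_low (n : nat) (Q : polygraph n) i k (x : fcat Q) :
  i < k <= n -> bd false i x = x -> weight k x = 0.
Proof.
elim: n Q k x => [|m IH] Q k x //= /andP[ik km].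
have im : i <= m by rewrite -ltnS; exact: leq_trans km.
rewrite /pbd im => h; rewrite -h; case: eqP => [ek|/eqP nk].
  by rewrite csize_idc.
have {}km : k <= m by rewrite -ltnS ltn_neqAle nk.
by rewrite src_idc; apply: IH; rewrite ?ik // bd_cbd // ltnn.
Qed.

(** In top dimension this is [csize0]: a cell without generators is an identity. Lower dimensions
    reduce to it by passing to sources. *)
Lemma weight0 (n : nat) (Q : polygraph n) i (x : fcat Q) :
  i < n -> bd false i.+1 x = x -> weight i.+1 x = 0 -> bd false i x = x.
Proof.
elim: n Q x => [|m IH] Q x //=; rewrite ltnS => im.
rewrite eqSS /pbd im; case: eqP => [->|/eqP nim].
  by move=> _ h; apply/esym/(@csize0 _ _ (free_pres (rules Q))).
have {im nim}im : i < m by rewrite ltn_neqAle nim.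
rewrite im => h hw; rewrite -[RHS]h; congr idc.
rewrite -[RHS]IH //; first by rewrite bd_cbd // ltnSn.
- by rewrite bd_cbd // ltnn.
- by move: hw; rewrite -{1}h src_idc.
Qed.

(* Higher dimensions take precedence: a context acts additively on the weight in
   dimension k only if its levels above k are trivial. *)
Definition lexlt (m : nat) (a b : nat -> nat) : Prop :=
  exists k, [/\ 0 < k <= m, a k < b k & forall l, k < l <= m -> a l = b l].

(** The highest coordinate is minimised first, then the lower ones among the elements attaining that
    minimum. *)
Lemma lex_min (T : Type) (sz : T -> nat -> nat) m (A : T -> Prop) t :
  A t -> exists2 t, A t & forall t', A t' -> ~ lexlt m (sz t') (sz t).
Proof.
elim: m A t => [|m IH] A t At.
  by exists t => // t' _ [k [/andP[k0 k0']]]; rewrite leqNgt k0 in k0'.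
have ex : exists k, `[< exists2 t, A t & sz t m.+1 = k >].
  by exists (sz t m.+1); apply/asboolP; exists t.
case: (ex_minnP ex) => k /asboolP[t1 At1 e1] kmin.
have [t2 [At2 e2] h2] := IH (fun t => A t /\ sz t m.+1 = k) t1 (conj At1 e1).
exists t2 => // t' At' [l [/andP[l0 lm] lt eq]].
move: lm; rewrite leq_eqVlt ltnS => /orP[/eqP el|lm].
  rewrite el e2 in lt.
  suff : k <= sz t' m.+1 by rewrite leqNgt lt.
  by apply: kmin; apply/asboolP; exists t'.
apply: (h2 t').
  by split=> //; rewrite eq ?e2 // ltnS lm leqnn.
exists l; split=> //; first by rewrite l0.
by move=> j /andP[lj jm]; apply: eq; rewrite lj leqW.
Qed.

Section Descent.
Variables (n : nat) (Q : polygraph n) (c : ctx (fcat Q)) (x : fcat Q).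
Hypothesis hc : ctxdim c n.
Hypothesis hx : cwdef c n x.

Lemma cwdefW i j : i <= j -> cwdef c j x -> cwdef c i x.
Proof.
elim: j => [|j IH]; first by rewrite leqn0 => /eqP->.
by rewrite leq_eqVlt => /orP[/eqP->//|]; rewrite ltnS => /IH h [] /h.
Qed.

Lemma weight_cwhiskS i l : i < l <= n ->
  weight l (cwhisk c i.+1 x) =
  weight l (c i).1 + weight l (cwhisk c i x) + weight l (c i).2.
Proof.
move=> il; have /andP[il1 il2] := il.
have [_ h1 h2] := cwdefW (leq_trans il1 il2) hx.
by rewrite /= !weight_comp // bd_comp // leqnn.
Qed.

Lemma weight_cwhisk j l : j < l <= n -> weight l (cwhisk c j x) = weight l x.
Proof.
elim: j => [|j IH] // /andP[jl ln].
have [h1 h2] := hc (leq_trans (ltnW jl) ln).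
rewrite weight_cwhiskS ?(ltnW jl) // IH ?(ltnW jl) //.
rewrite (weight_low (x := (c j).1) _ h1) ?jl //.
by rewrite (weight_low (x := (c j).2) _ h2) ?jl // addn0.
Qed.

(** Proceeding from the top level down: once the levels above i are trivial, the weight in dimension
    i+1 grows exactly by the weights of the two cells of level i, which must therefore vanish. *)
Lemma cwhisk_descent :
  ~ lexlt n (fun k => weight k x) (fun k => weight k (cwhisk c n x)) ->
  forall i, i < n -> bd false i (c i).1 = (c i).1 /\ bd false i (c i).2 = (c i).2.
Proof.
(* Here [d] counts the upper levels already known to be trivial. *)
move=> hlt; suff h d : d <= n -> forall i, n - d <= i < n ->
    bd false i (c i).1 = (c i).1 /\ bd false i (c i).2 = (c i).2.
  by move=> i hi; apply: (h n) => //; rewrite subnn.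
elim: d => [|d IH] dn i /andP[di hi].
  by move: di; rewrite subn0 leqNgt hi.
have {}IH := IH (ltnW dn).
move: di; rewrite leq_eqVlt => /orP[/eqP ei|di]; last first.
  by apply: IH; rewrite hi andbT -(subnSK dn).
have ed : n - d = i.+1 by rewrite -ei subnSK.
have ew : cwhisk c n x = cwhisk c i.+1 x.
  by apply: cwhisk_degenerate => // l hl; apply: IH; rewrite ed.
have [h1 h2] := hc hi.
have wi : weight i.+1 (cwhisk c n x) =
    weight i.+1 (c i).1 + weight i.+1 x + weight i.+1 (c i).2.
  by rewrite ew weight_cwhiskS ?ltnSn // weight_cwhisk ?ltnSn.
have [w1 w2] : weight i.+1 (c i).1 = 0 /\ weight i.+1 (c i).2 = 0.
  suff : weight i.+1 (c i).1 + weight i.+1 (c i).2 == 0.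
    by rewrite addn_eq0 => /andP[/eqP-> /eqP->].
  rewrite -leqn0 leqNgt; apply/negP => w0; apply: hlt; exists i.+1.
  split=> //.
    by rewrite wi addnAC -[X in X < _]add0n ltn_add2r.
  by move=> l hl; rewrite ew weight_cwhisk.
by split; apply: weight0.
Qed.

End Descent.

(** * Fillable squares *)

Section IdentityContext.
Variables (n : nat) (D : ncat n).

(** An identity context adapted to [x]: each level consists of units for [x]. It is wanted because
    [dgen] always inserts a context. *)
Definition idctx (x : D) : ctx D := fun j => (bd false j x, bd true j x).

Lemma idctxP (x : D) j :
  ctxdim (idctx x) j /\ cwdef (idctx x) j x.
Proof.
split=> [i _|]; first by rewrite /= !bd_bd ltnNge leqnSn.
suff h : cwdef (idctx x) j x /\ cwhisk (idctx x) j x = x by case: h.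
by elim: j => [|j [IH e]] //=; rewrite e comp_idl comp_idr !bd_bd ltnn.
Qed.

End IdentityContext.

Lemma whisk_idctx (n : nat) (C : ncat n) (P : pres C) (x : C) (q : cell P) :
  (forall e i, i < n -> bd e i x = cbd e i q) ->
  whiskable (idctx x) q /\ whisk (idctx x) q = q.
Proof.
move=> h; have [hc hd] := idctxP x n.
have w : whiskable (idctx x) q.
  apply/whiskableE; split=> //; apply: cwdef_par hd => // e i hi.
  by rewrite h //; have [->] := cbd_src_tgt q e hi.
split=> //; apply: whisk_degenerate => // i _.
by rewrite /= !bd_bd ltnn.
Qed.

Section Filling.
Variables (n : nat) (C : ncat n) (V H : pres C) (L : sqext V H).

Lemma dcell_bd f g e e' : dcell L f g e e' ->
  [/\ src f = src e, tgt f = src e', src g = tgt e & tgt g = tgt e'].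
Proof.
elim=> {f g e e'} [c A w|f|e|f g f' g' e e' e'' _ [h1 h2 h3 h4] _ [k1 k2 k3 k4]|
  f g h e e' d d' _ [h1 h2 h3 h4] _ [k1 k2 k3 k4]|f g e e' hV _ [h1 h2 h3 h4]|
  f g e e' hH _ [h1 h2 h3 h4]].
- have wl := whiskable_src (sq_tl (sqbd A)) w.
  have wr := whiskable_comp (sq_tr (sqbd A)) w.
  have wb := whiskable_comp (esym (sq_bl (sqbd A))) wl.
  by rewrite !src_whisk // !tgt_whisk // sq_tl sq_tr sq_bl sq_br.
- by rewrite !src_idc !tgt_idc.
- by rewrite !src_idc !tgt_idc.
- by rewrite !src_vcomp ?tgt_vcomp ?h2 ?h4.
- by rewrite !src_vcomp ?tgt_vcomp // -?h3 -?h4.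
- by rewrite !src_invc // !tgt_invc.
- by rewrite !src_invc // !tgt_invc.
Qed.

Lemma filled_bd f g e e' : filled L f g e e' ->
  [/\ src f = src e, tgt f = src e', src g = tgt e & tgt g = tgt e'].
Proof. by case=> /dcell_bd. Qed.

(** The four edges are parallel below dimension n, so the identity context of one corner fixes all
    of them. *)
Lemma filled_gen (A : L) :
  filled L (sq_top (sqbd A)) (sq_bot (sqbd A)) (sq_left (sqbd A)) (sq_right (sqbd A)).
Proof.
set Q := sqbd A.
have ht e i : i < n -> bd e i (src (sq_top Q)) = cbd e i (sq_top Q).
  by move=> hi; have [] := cbd_src_tgt (sq_top Q) e hi.
have hl e i : i < n -> bd e i (src (sq_top Q)) = cbd e i (sq_left Q).
  by move=> hi; rewrite sq_tl; have [] := cbd_src_tgt (sq_left Q) e hi.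
have hr e i : i < n -> bd e i (src (sq_top Q)) = cbd e i (sq_right Q).
  move=> hi; rewrite ht // -(proj2 (cbd_src_tgt (sq_top Q) e hi)) sq_tr.
  by have [] := cbd_src_tgt (sq_right Q) e hi.
have hb e i : i < n -> bd e i (src (sq_top Q)) = cbd e i (sq_bot Q).
  move=> hi; rewrite hl // -(proj2 (cbd_src_tgt (sq_left Q) e hi)) -sq_bl.
  by have [] := cbd_src_tgt (sq_bot Q) e hi.
have [w et] := whisk_idctx ht; have [_ el] := whisk_idctx hl.
have [_ er] := whisk_idctx hr; have [_ eb] := whisk_idctx hb.
by constructor; have := dgen w; rewrite -/Q et el er eb.
Qed.

Lemma filled_paste_v f g f' g' e e' e'' : filled L f g e e' ->
  filled L f' g' e' e'' -> filled L (f ** f') (g ** g') e e''.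
Proof. by move=> [a] [b]; constructor; exact: dpaste_v a b. Qed.

Lemma filled_paste_h f g h e e' d d' : filled L f g e e' ->
  filled L g h d d' -> filled L f h (e ** d) (e' ** d').
Proof. by move=> [a] [b]; constructor; exact: dpaste_h a b. Qed.

Hypotheses (hV : pinv V) (hH : pinv H).

Lemma filled_inv_h f g e e' : filled L f g e e' -> filled L g f (invc e) (invc e').
Proof. by move=> [a]; constructor; exact: dinv_h. Qed.

Lemma filled_inv_v f g e e' : filled L f g e e' -> filled L (invc f) (invc g) e' e.
Proof. by move=> [a]; constructor; exact: dinv_v. Qed.

Definition esim (e e' : cell V) : Prop :=
  filled L (idc (src e)) (idc (tgt e)) e e'.

Lemma esim_bd e e' : esim e e' -> src e = src e' /\ tgt e = tgt e'.
Proof. by move=> /filled_bd[_]; rewrite !tgt_idc => h _ h'. Qed.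

Lemma esim_refl e : esim e e.
Proof. by constructor; exact: did_v. Qed.

Lemma esim_sym e e' : esim e e' -> esim e' e.
Proof.
move=> h; rewrite /esim; have [<- <-] := esim_bd h.
by have := filled_inv_v h; rewrite !invc_idc.
Qed.

Lemma esim_trans e e' e'' : esim e e' -> esim e' e'' -> esim e e''.
Proof.
move=> h h'; have [s t] := esim_bd h; rewrite /esim.
have := filled_paste_v h h'.
by rewrite -s -t !vcomp_idl ?src_idc.
Qed.

Lemma esim_comp e d e' d' : tgt e = src d -> esim e e' -> esim d d' ->
  esim (e ** d) (e' ** d').
Proof.
move=> h h1 h2; rewrite /esim src_vcomp // tgt_vcomp //.
by apply: filled_paste_h h1 _; rewrite h.
Qed.

Lemma esim_inv e e' : esim e e' -> esim (invc e) (invc e').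
Proof. by move=> h; rewrite /esim src_invc // tgt_invc //; exact: filled_inv_h. Qed.

Hypothesis contractible : forall e e' : cell V,
  src e = src e' -> tgt e = tgt e' -> esim e e'.

(* Vertical cells being contractible, f ~ g says that every square with top f
   and bottom g can be filled. *)
Definition hsim (f g : cell H) : Prop := exists e e', filled L f g e e'.

Lemma hsim_filled f g e e' : hsim f g -> src f = src e -> tgt f = src e' ->
  src g = tgt e -> tgt g = tgt e' -> filled L f g e e'.
Proof.
(* Squares with identity top and bottom, pasted on the left and on the right, exchange the given
   vertical sides for the prescribed ones. *)
move=> [d [d' h]] h1 h2 h3 h4; have [k1 k2 k3 k4] := filled_bd h.
have c1 : esim e d by apply: contractible; rewrite -?h1 -?h3.
have c2 : esim d' e' by apply: contractible; rewrite -?h2 -?h4.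
have := filled_paste_v (filled_paste_v c1 h) c2.
by rewrite -h1 -h3 -k2 -k4 !vcomp_idl // !vcomp_idr.
Qed.

Lemma hsim_refl f : hsim f f.
Proof. by exists (idc (src f)), (idc (tgt f)); constructor; exact: did_h. Qed.

Lemma hsim_sym f g : hsim f g -> hsim g f.
Proof. by move=> [e [e' h]]; exists (invc e), (invc e'); exact: filled_inv_h. Qed.

Lemma hsim_trans f g h : hsim f g -> hsim g h -> hsim f h.
Proof.
move=> [e [e' h1]] [d [d' h2]].
by exists (e ** d), (e' ** d'); exact: filled_paste_h h1 h2.
Qed.

(** The two given squares need not share an edge; contractibility refills the second one with the
    right edge of the first as its left edge. *)
Lemma hsim_comp f g f' g' : tgt f = src f' -> tgt g = src g' ->
  hsim f g -> hsim f' g' -> hsim (f ** f') (g ** g').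
Proof.
move=> hf hg [e [e' h]] h'; have [k1 k2 k3 k4] := filled_bd h.
have [d [d' h'']] := h'; have [m1 m2 m3 m4] := filled_bd h''.
exists e, d'; apply: filled_paste_v h _.
by apply: hsim_filled => //; rewrite -?hf -?hg.
Qed.

Lemma hsim_inv f g : hsim f g -> hsim (invc f) (invc g).
Proof. by move=> [e [e' h]]; exists e', e; exact: filled_inv_v. Qed.

Lemma hsim_idc (e : cell V) : hsim (idc (src e)) (idc (tgt e)).
Proof. by exists e, e; exact: esim_refl. Qed.

End Filling.

(** * Transport of fillings to invertible horizontal cells *)

Section FillingLocalisation.
Variables (n : nat) (C : ncat n) (V : pres C) (X : cellext C).
Variables (R : term X -> term X -> Prop).
Variables (L : sqext V (Pres X false R)) (M : sqext V (Pres X true R)).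
Variable emb : L -> M.

Notation loc := (@pmap n C (Pres X false R) (Pres X true R) id).

Hypothesis hemb : forall A,
  [/\ sq_top (sqbd (emb A)) = loc (sq_top (sqbd A)),
      sq_bot (sqbd (emb A)) = loc (sq_bot (sqbd A)),
      sq_left (sqbd (emb A)) = sq_left (sqbd A) &
      sq_right (sqbd (emb A)) = sq_right (sqbd A)].

Lemma filled_loc f g e e' : filled L f g e e' -> filled M (loc f) (loc g) e e'.
Proof.
move=> [a]; elim: a => {f g e e'} [c A w|f|e|f g f' g' e e' e'' a IHa b IHb|
  f g h e e' d d' a IHa b IHb|f g e e' hV a IHa|//].
- have [ht hb hl hr] := hemb A.
  have wb : whiskable c (sq_bot (sqbd A)).
    apply: whiskable_comp (esym (sq_bl (sqbd A))) _.
    exact: whiskable_src (sq_tl (sqbd A)) w.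
  rewrite !loc_whisk // -ht -hb -hl -hr; constructor; apply: dgen.
  by rewrite ht; apply/whiskable_loc.
- by rewrite -src_loc -tgt_loc; constructor; exact: did_h.
- by rewrite !loc_idc; constructor; exact: did_v.
- have [h1 h2 h3 h4] := dcell_bd a; have [k1 k2 k3 k4] := dcell_bd b.
  rewrite !loc_vcomp; first exact: filled_paste_v IHa IHb.
    by rewrite h4 k3.
  by rewrite h2 k1.
- exact: filled_paste_h IHa IHb.
- exact: filled_inv_h.
Qed.

End FillingLocalisation.

Lemma E_star_top_vcomp (n : nat) (P : polygraph_modulo n) (p q : cell (E_star P)) :
  tgt p = src q -> E_star_top (p ** q) = E_star_top p ** E_star_top q.
Proof. exact: loc_vcomp. Qed.

Lemma S_star_top_vcomp (n : nat) (P : polygraph_modulo n) (p q : cell (S_star P)) :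
  tgt p = src q -> S_star_top (p ** q) = S_star_top p ** S_star_top q.
Proof. exact: loc_vcomp. Qed.

(** * Coherence of E *)

Section Squier.
Variables (n : nat) (P : polygraph_modulo n).
Variable kappa : forall b : critical_branching P, confluence b.
Variables (H : pres (base P)) (hH : pinv H) (L : sqext (E_top P) H).
Hypothesis hSE : forall c (b : critical_branching P), whiskable c (cb1 b) ->
  esim L (whisk c (E_star_top (cb1 b ** cf1 (kappa b))))
    (whisk c (E_star_top (cb2 b ** cf2 (kappa b)))).
Hypothesis hE : convergent (extend (E_ext P)).

Notation loc := (@E_star_top n P).
Implicit Types (e d : cell (E_star P)).

(* The inner branching is taken of lexicographically minimal weight: a further
   context would then have only trivial levels. *)
Lemma whisk_branching e e' : local_branching e e' ->
  exists c d d', [/\ local_branching d d', whiskable c d, whiskable c d',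
    e = whisk c d & e' = whisk c d'] /\
    [\/ d = d', peiffer_branching d d', peiffer_branching d' d | critical d d'].
Proof.
move=> hb; have [h1 h2 hs] := hb.
pose A (t : ctx (base P) * (cell (E_star P) * cell (E_star P))) :=
  [/\ local_branching t.2.1 t.2.2, whiskable t.1 t.2.1, whiskable t.1 t.2.2,
    e = whisk t.1 t.2.1 & e' = whisk t.1 t.2.2].
pose sz (t : ctx (base P) * (cell (E_star P) * cell (E_star P))) k :=
  @weight n (trunc (pm_R P)) k (src t.2.1).
have At : A (idctx (src e), (e, e')).
  have wid (q : cell (E_star P)) : src e = src q ->
      whiskable (idctx (src e)) q /\ whisk (idctx (src e)) q = q.
    move=> ->; apply: whisk_idctx => d i hi.
    by have [] := cbd_src_tgt q d hi.
  have [w1 w2] := wid _ erefl; have [w3 w4] := wid _ hs.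
  by split; rewrite /= ?w2 ?w4.
have [[c [d d']] [/= hd wd wd' ed ed'] hmin] := lex_min sz n At.
exists c, d, d'; split=> //.
case: (pselect (d = d')) => [|neq]; first by constructor 1.
case: (pselect (peiffer_branching d d')) => [|np]; first by constructor 2.
case: (pselect (peiffer_branching d' d)) => [|np']; first by constructor 3.
constructor 4; split=> // c' d0 d0' hd0 w w' e0 e0'.
rewrite e0 in wd ed; rewrite e0' in wd' ed'.
have [k1 k2] := whisk_cctx w wd; have [k1' k2'] := whisk_cctx w' wd'.
have A0 : A (cctx c c', (d0, d0')) by split; rewrite ?k2 ?k2'.
have [hc hx] := (whiskableE c' d0).1 w.
have hdeg := @cwhisk_descent n (trunc (pm_R P)) c' (src d0) hc hx.
have {}hdeg : forall i, i < n ->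
    bd false i (c' i).1 = (c' i).1 /\ bd false i (c' i).2 = (c' i).2.
  apply: hdeg; have := hmin _ A0; rewrite /sz /= e0.
  by rewrite src_whisk.
by rewrite e0 e0' !whisk_degenerate.
Qed.

(** Trivial and Peiffer branchings close by an equality in [E_star], critical ones by a cell of the
    Squier extension; whiskering preserves both. *)
Lemma local_confluence e e' : local_branching e e' ->
  exists e1 e1', [/\ tgt e = src e1, tgt e' = src e1' &
    esim L (loc (e ** e1)) (loc (e' ** e1'))].
Proof.
move=> /whisk_branching[c [d [d' [[hd wd wd' -> ->] h]]]].
have [h1 h2 hs] := hd.
have commutes q q' r r' : whiskable c q -> whiskable c q' -> tgt q = src r ->
    tgt q' = src r' -> q ** r = q' ** r' -> exists e1 e1',
    [/\ tgt (whisk c q) = src e1, tgt (whisk c q') = src e1' &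
      esim L (loc (whisk c q ** e1)) (loc (whisk c q' ** e1'))].
  move=> wq wq' hr hr' e0; exists (whisk c r), (whisk c r').
  have wr := whiskable_comp hr wq; have wr' := whiskable_comp hr' wq'.
  rewrite !tgt_whisk // !src_whisk // hr hr'; split=> //.
  by rewrite -!whisk_vcomp // e0; exact: esim_refl.
have peiffer q q' : peiffer_branching q q' -> exists r r',
    [/\ tgt q = src r, tgt q' = src r' & q ** r = q' ** r'].
  move=> [i [a [b [hi hab -> ->]]]].
  have ha : cbd true i a = bd false i (src b) by have [->] := cbd_src_tgt b false hi.
  have hb : bd true i (tgt a) = cbd false i b by have [_ ->] := cbd_src_tgt a true hi.
  have ha' : cbd true i a = bd false i (tgt b) by have [_ ->] := cbd_src_tgt b false hi.
  have hb' : bd true i (src a) = cbd false i b by have [->] := cbd_src_tgt a true hi.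
  exists (lcomp i (tgt a) b), (rcomp i a (tgt b)); split.
  - by rewrite tgt_rcomp // src_lcomp.
  - by rewrite tgt_lcomp // src_rcomp.
  - by rewrite -pcomp_whisk // pcomp_whisk_swap.
case: h => [edd|/peiffer[r [r' [hr hr' err]]]|/peiffer[r [r' [hr hr' err]]]|hcrit].
- by apply: (commutes d d' (idc (tgt d)) (idc (tgt d'))); rewrite ?src_idc // edd.
- exact: commutes hr hr' err.
- exact: commutes hr' hr (esym err).
- pose b := CriticalBranching hcrit.
  have [s1 s2] := (cf_src1 (kappa b), cf_src2 (kappa b)).
  exists (whisk c (cf1 (kappa b))), (whisk c (cf2 (kappa b))).
  have w1 := whiskable_comp (esym s1) wd; have w2 := whiskable_comp (esym s2) wd'.
  rewrite !tgt_whisk // !src_whisk // s1 s2; split=> //.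
  rewrite -!whisk_vcomp //.
  have := @hSE c b wd.
  rewrite -!loc_whisk //.
  + by apply: whiskable_src wd'; rewrite src_vcomp.
  + by apply: whiskable_src wd; rewrite src_vcomp.
Qed.

(** Otherwise every counterexample admits a step to another one, and choice produces an infinite
    rewriting sequence. *)
Lemma E_step_ind (F : base P -> Prop) :
  (forall u, (forall s : cell (E_star P), rewriting_step s -> src s = u ->
    F (tgt s)) -> F u) ->
  forall u, F u.
Proof.
move=> hF u; apply: contrapT => hu; have [term _] := hE; apply: term.
pose T := {s : cell (E_star P) | rewriting_step s /\ ~ F (tgt s)}.
have next v : ~ F v -> exists s : T, src (sval s) = v.
  move=> hv; apply: contrapT => hn; apply: hv; apply: hF => s hs es.
  apply: contrapT => hs'; apply: hn.
  by exists (exist _ s (conj hs hs')).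
have [s0 _] := next u hu.
have [nx hnx] := choice (fun s : T => next _ (proj2 (proj2_sig s))).
exists (fun i => sval (iter i nx s0)) => i /=; split.
  by case: (svalP (iter i nx s0)).
by rewrite hnx.
Qed.

Notation Enf u := (normal_form (E_star P) u).

(** The cells completing the confluence start at normal forms, hence are identities. *)
Lemma E_nf_unique e e' : src e = src e' -> Enf (tgt e) -> Enf (tgt e') ->
  tgt e = tgt e'.
Proof.
move=> hs h h'; have [_ conf] := hE; have [f [f' [s s' t]]] := conf e e' hs.
have ef : f = idc (src f) by apply: normal_form_idc => //; rewrite s.
have ef' : f' = idc (src f') by apply: normal_form_idc => //; rewrite s'.
by rewrite -s -s' -(tgt_idc (E_star P) (src f)) -ef t ef' tgt_idc src_idc.
Qed.

Variable rho : strategy (E_star P).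

Lemma esim_to_nf u e e' : src e = u -> src e' = u -> Enf (tgt e) -> Enf (tgt e') ->
  esim L (loc e) (loc e').
Proof.
elim/E_step_ind: u e e' => u IH e e' hs hs' h h'.
have ht : tgt e = tgt e' by apply: E_nf_unique; rewrite ?hs.
(* If one cell is an identity, the common source is already normal and the other cell is an identity
   too. *)
have triv (q q' : cell (E_star P)) : src q = src q' -> tgt q = tgt q' ->
    Enf (tgt q) -> q = idc (src q) -> q = q'.
  move=> hq hq' hn eq; rewrite eq hq; apply/esym/normal_form_idc => //.
  by rewrite -hq -(tgt_idc (E_star P) (src q)) -eq.
case: (@first_step _ _ (E_star P) erefl (fun _ _ f => match f with end) e) =>
  [ee|[s [r [st hr er]]]].
  have <- := triv e e' (etrans hs (esym hs')) ht h ee; exact: esim_refl.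
case: (@first_step _ _ (E_star P) erefl (fun _ _ f => match f with end) e') =>
  [ee'|[s' [r' [st' hr' er']]]].
  have <- := triv e' e (etrans hs' (esym hs)) (esym ht) h' ee'; exact: esim_refl.
have es : src s = u by rewrite -hs er src_vcomp.
have es' : src s' = u by rewrite -hs' er' src_vcomp.
have [|t [t' [h1 h2 h3]]] := @local_confluence s s'; first by split; rewrite ?es.
have ett : tgt t = tgt t'.
  have [_] := esim_bd h3.
  by rewrite !tgt_E_star_top !tgt_vcomp.
(* The local confluence is prolonged to a normal form, so that the induction hypothesis applies
   after [s] and after [s']. Since [t] and [t'] have the same target, one [x] serves both sides. *)
pose x := rho (tgt t).
have hx : tgt t = src x by rewrite strat_src.
have hx' : tgt t' = src x by rewrite strat_src.
have etr : tgt r = tgt e by rewrite er tgt_vcomp.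
have etr' : tgt r' = tgt e' by rewrite er' tgt_vcomp.
have a1 : esim L (loc r) (loc (t ** x)).
  apply: (IH s) => //; rewrite ?src_vcomp ?tgt_vcomp ?etr //; exact: strat_nf.
have a2 : esim L (loc r') (loc (t' ** x)).
  apply: (IH s') => //; rewrite ?src_vcomp ?tgt_vcomp ?etr' //; exact: strat_nf.
have split_step q v w : tgt q = src v -> tgt v = src w ->
    loc (q ** v ** w) = loc q ** loc (v ** w).
  by move=> hv hw; rewrite vcompA // E_star_top_vcomp // src_vcomp.
have b1 : esim L (loc e) (loc (s ** t ** x)).
  rewrite er split_step // E_star_top_vcomp //.
  apply: esim_comp a1; last exact: esim_refl.
  by rewrite tgt_E_star_top src_E_star_top.
have b2 : esim L (loc e') (loc (s' ** t' ** x)).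
  rewrite er' split_step // E_star_top_vcomp //.
  apply: esim_comp a2; last exact: esim_refl.
  by rewrite tgt_E_star_top src_E_star_top.
apply: esim_trans b1 (esim_trans _ (esim_sym hH b2)).
rewrite !(E_star_top_vcomp (q := x)) ?tgt_vcomp //.
by apply: esim_comp h3 (esim_refl _ _); rewrite tgt_E_star_top src_E_star_top tgt_vcomp.
Qed.

Lemma E_top_nf (e : cell (E_top P)) : nf rho (src e) = nf rho (tgt e) /\
  esim L e (loc (rho (src e)) ** invc (loc (rho (tgt e)))).
Proof.
have src_rho u : src (loc (rho u)) = u by rewrite src_E_star_top strat_src.
have tgt_rho u : tgt (loc (rho u)) = nf rho u by rewrite tgt_E_star_top.
rewrite -!tgt_rho; move: e.
apply: (zigzag_telescope (N := fun u => loc (rho u)) (sim := esim L)).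
- by move=> p q p' q' h _; exact: esim_comp.
- by move=> p q; exact: esim_inv.
move=> q; have h : tgt q = src (rho (tgt q)) by rewrite strat_src.
(* Both cells lead from the source of [q] to a normal form; composing with the inverse of
   [rho (tgt q)] then isolates [q]. *)
have h1 : esim L (loc (q ** rho (tgt q))) (loc (rho (src q))).
  by apply: (@esim_to_nf (src q)); rewrite ?src_vcomp ?tgt_vcomp ?strat_src //;
    exact: strat_nf.
have [_] := esim_bd h1; rewrite !tgt_E_star_top tgt_vcomp // => hn; split=> //.
have := esim_comp _ h1 (esim_refl L (invc (loc (rho (tgt q))))).
rewrite E_star_top_vcomp // vcompA ?src_invc ?tgt_E_star_top ?src_E_star_top //.
rewrite vcomp_invr // src_rho vcomp_idr ?tgt_E_star_top //; apply.
by rewrite tgt_vcomp tgt_E_star_top ?src_E_star_top.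
Qed.

Lemma E_top_contractible (e e' : cell (E_top P)) :
  src e = src e' -> tgt e = tgt e' -> esim L e e'.
Proof.
move=> hs ht; have [_ h] := E_top_nf e; have [_ h'] := E_top_nf e'.
by apply: esim_trans h _; rewrite hs ht; exact: esim_sym.
Qed.

Lemma nf_E_top (e : cell (E_top P)) : nf rho (src e) = nf rho (tgt e).
Proof. by have [] := E_top_nf e. Qed.


End Squier.

(** * Coherence of S *)

Lemma tsize_twhisk (n : nat) (C : ncat n) (X : cellext C) c j (a : term X) :
  tsize (twhisk c j a) = tsize a.
Proof. by elim: j => //= j ->; rewrite addn0. Qed.

(** Only single whiskered generators are identified, so size remains meaningful in [S_star]. *)
Lemma triple_rel_size (n : nat) (P : polygraph_modulo n)
  (a b : term (pgen (S_star P))) : prel a b -> tsize a = tsize b.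
Proof. by move=> [x [y [c [d [[_ _ -> ->] _]]]]]; rewrite !tsize_twhisk. Qed.

Lemma S_normal_idc (n : nat) (P : polygraph_modulo n) (q : cell (S_star P)) :
  normal_form (S_star P) (src q) -> q = idc (src q).
Proof. by apply: normal_form_idc => //; exact: triple_rel_size. Qed.

Section Coherence.
Variables (n : nat) (P : polygraph_modulo n) (Gamma : square_extension P).
Hypothesis hGamma : diconvergent Gamma.
Variables (sigma : strategy (S_star P)) (rho : strategy (E_star P)).
Variables (eta : weak_commutation sigma rho).
Variable kappa : forall b : critical_branching P, confluence b.

Notation L := (lift_ext (squnion (squier Gamma kappa) (N_ext eta))).
Notation loc := (@S_star_top n P).

Let hV : pinv (E_top P). Proof. by []. Qed.
Let hH : pinv (S_top P). Proof. by []. Qed.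

Lemma squier_esim c (b : critical_branching P) : whiskable c (cb1 b) ->
  esim L (whisk c (E_star_top (cb1 b ** cf1 (kappa b))))
    (whisk c (E_star_top (cb2 b ** cf2 (kappa b)))).
Proof.
move=> w; pose A : L := inl (inr b).
have h1 := cf_src1 (kappa b).
have w1 : whiskable c (sq_top (sqbd A)).
  by apply: whiskable_src w; rewrite src_S_star_top src_idc.
have : filled L (whisk c (sq_top (sqbd A))) (whisk c (sq_bot (sqbd A)))
    (whisk c (sq_left (sqbd A))) (whisk c (sq_right (sqbd A))).
  by constructor; exact: dgen.
have wb : whiskable c (sq_bot (sqbd A)).
  apply: whiskable_comp (esym (sq_bl (sqbd A))) _.
  exact: whiskable_src (sq_tl (sqbd A)) w1.
(* Localisation and whiskering preserve identities, so top and bottom of the whiskered Squier cell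
   are the identities required by [esim]. *)
move: w1 wb; rewrite /= /S_star_top !loc_idc => w1 wb.
rewrite !whisk_idc // => h; have [s _ t _] := filled_bd h.
by move: h; rewrite /esim -s -t !src_idc.
Qed.

Let hE : convergent (extend (E_ext P)). Proof. by case: hGamma. Qed.

Lemma contractible (e e' : cell (E_top P)) :
  src e = src e' -> tgt e = tgt e' -> esim L e e'.
Proof. exact: (E_top_contractible hH squier_esim hE rho). Qed.

Notation "f ~ g" := (hsim L f g) (at level 70).

(** The cells completing the branching start at S-normal forms, so they are identities and the
    confluence square has top [f] and bottom [g] themselves. *)
Lemma branching_hsim (f g : cell (S_star P)) (e : cell (E_top P)) :
  f <> idc (src f) -> src f = src e -> src g = tgt e ->
  normal_form (S_star P) (tgt f) -> normal_form (S_star P) (tgt g) ->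
  loc f ~ loc g.
Proof.
move=> nf hf hg nt nt'; have [_ hb _] := hGamma.
have [f' [g' [e' [h1 h2 h3]]]] := hb f e g nf hf hg.
rewrite h1 in nt; rewrite h2 in nt'.
rewrite (S_normal_idc nt) (S_normal_idc nt') -h1 -h2 !vcomp_idr // in h3.
(* The double [inl] selects the biaction and Peiffer cells inside the extension. *)
exists e, e'; apply: (@filled_loc _ _ _ _ _ _ L (fun A => inl (inl A))) h3.
by [].
Qed.

(** A branching needs a nontrivial first leg: if the strategy is trivial at the source, the
    branching is read backwards along [e]; if it is trivial at both ends, the identity square on [e]
    suffices. *)
Lemma sigma_E (e : cell (E_top P)) : loc (sigma (src e)) ~ loc (sigma (tgt e)).
Proof.
have nt u := @strat_nf _ _ _ sigma u; have ss u := strat_src sigma u.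
case: (pselect (sigma (src e) = idc (src (sigma (src e))))) => [e1|h]; last first.
  by apply: (branching_hsim (e := e)).
case: (pselect (sigma (tgt e) = idc (src (sigma (tgt e))))) => [e2|h]; last first.
  apply: hsim_sym => //; apply: (branching_hsim (e := invc e)) => //.
    by rewrite src_invc.
  by rewrite tgt_invc.
rewrite e1 e2 !ss /S_star_top !loc_idc; exact: hsim_idc.
Qed.

Lemma sigma_S (f : cell (S_star P)) :
  loc (f ** sigma (tgt f)) ~ loc (sigma (src f)).
Proof.
have h : tgt f = src (sigma (tgt f)) by rewrite strat_src.
have sf : src (f ** sigma (tgt f)) = src f by rewrite src_vcomp.
have nt u := @strat_nf _ _ _ sigma u; set g := f ** _ in sf *.
have ng : normal_form (S_star P) (tgt g) by rewrite tgt_vcomp.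
(* If [g] is an identity, the source of [f] is an S-normal form and [sigma] is an identity there as
   well. *)
case: (pselect (g = idc (src g))) => [e|hg]; last first.
  by apply: (branching_hsim (e := idc (src g))); rewrite ?src_idc ?tgt_idc ?strat_src.
have -> : sigma (src f) = g.
  rewrite {1}e sf -[in RHS](strat_src sigma (src f)); apply: S_normal_idc.
  by rewrite strat_src -sf -(tgt_idc (S_star P) (src g)) -e.
exact: hsim_refl.
Qed.

Lemma sigma_eta u : loc (sigma u) ~ loc (eta u).
Proof.
exists (E_star_top (rho u)), (E_star_top (rho (nf sigma u))).
exact: (@filled_gen _ _ _ _ L (inr u)).
Qed.

Lemma S_top_nf (f : cell (S_top P)) :
  nf rho (nf sigma (src f)) = nf rho (nf sigma (tgt f)) /\
  f ~ loc (eta (src f)) ** invc (loc (eta (tgt f))).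
Proof.
have tgt_eta u : tgt (loc (eta u)) = nf rho (nf sigma u).
  by rewrite tgt_S_star_top wcom_tgt.
rewrite -!tgt_eta; move: f.
apply: (zigzag_telescope (N := fun u => loc (eta u)) (sim := hsim L)).
- by move=> p q p' q'; exact: (hsim_comp contractible).
- by move=> p q; exact: (hsim_inv hH).
move=> f; have h : tgt f = src (sigma (tgt f)) by rewrite strat_src.
have hf := sigma_S f.
(* The right edge [d'] is an E-zigzag between the two chosen S-normal forms, which therefore have
   the same E-normal form. *)
have [d [d' hd]] := hf; have [_ k2 _ k4] := filled_bd hd.
rewrite !tgt_S_star_top tgt_vcomp // in k2 k4.
have hn : nf rho (nf sigma (src f)) = nf rho (nf sigma (tgt f)).
  rewrite /(nf sigma) k2 k4; apply/esym.
  exact: (nf_E_top hH squier_esim hE rho d').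
rewrite !tgt_eta; split=> //.
have ht : tgt (loc (f ** sigma (tgt f))) = src (invc (loc (sigma (tgt f)))).
  by rewrite src_invc // !tgt_S_star_top tgt_vcomp.
have e : loc f = loc (f ** sigma (tgt f)) ** invc (loc (sigma (tgt f))).
  rewrite S_star_top_vcomp // vcompA; first 1 last.
  - by rewrite tgt_S_star_top src_S_star_top.
  - by rewrite src_invc.
  by rewrite vcomp_invr // src_S_star_top -h vcomp_idr // tgt_S_star_top.
rewrite -[X in hsim _ X _]/(loc f) e; apply: (hsim_comp contractible) => //.
- by rewrite src_invc // !tgt_eta.
- exact: hsim_trans hf (sigma_eta _).
- by apply: hsim_inv => //; exact: sigma_eta.
Qed.

Lemma eta_E (e : cell (E_top P)) : loc (eta (src e)) ~ loc (eta (tgt e)).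
Proof.
apply: hsim_trans (hsim_sym _ (sigma_eta _)) _ => //.
exact: hsim_trans (sigma_E e) (sigma_eta _).
Qed.

End Coherence.

Theorem theorem6p3p3 (n : nat) (P : polygraph_modulo n)
  (Gamma : square_extension P) (hGamma : diconvergent Gamma)
  (sigma : strategy (S_star P)) (rho : strategy (E_star P))
  (eta : weak_commutation sigma rho)
  (kappa : forall b : critical_branching P, confluence b) :
  coherent (squnion (squier Gamma kappa) (N_ext eta)).
Proof.
have hE := contractible hGamma eta kappa.
have hV : pinv (E_top P) by []; have hH : pinv (S_top P) by [].
move=> Q; apply: (hsim_filled hE); last first;
  rewrite ?sq_tl ?sq_tr ?sq_bl ?sq_br //.
have [n1 h1] := S_top_nf hGamma eta kappa (sq_top Q).
have [n2 h2] := S_top_nf hGamma eta kappa (sq_bot Q).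
(* Top and bottom are replaced by their [eta] zigzags, whose ends are then compared along the left
   and right sides of the square. *)
apply: hsim_trans h1 (hsim_trans _ (hsim_sym hV h2)).
apply: (hsim_comp hE).
- by rewrite src_invc // !tgt_S_star_top !wcom_tgt.
- by rewrite src_invc // !tgt_S_star_top !wcom_tgt.
- by rewrite sq_tl sq_bl; exact: eta_E.
- by apply: (hsim_inv hH); rewrite sq_tr sq_br; exact: eta_E.
Qed.
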